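(* If $\varphi_1$ and $\varphi_2$ are indecomposable $\mathfrak{S}_\infty$-central states on $\Gamma\wr\mathfrak{S}_\infty$ such that the corresponding GNS-representations $\pi_{\varphi_1}$ and $\pi_{\varphi_2}$ are quasiequivalent, then $\varphi_1=\varphi_2$.
   Context: $\mathfrak{S}_\infty$ is the (discrete) group of all bijections $s:\mathbb{N}\to\mathbb{N}$, $\mathbb{N}=\{1,2,\ldots\}$, moving only finitely many points. $\Gamma$ is a separable topological group with identity $e$; $\Gamma^\infty_e$ is the group of sequences $\gamma=(\gamma_1,\gamma_2,\ldots)$ in $\Gamma$ with only finitely many $\gamma_i\neq e$, with the inductive limit topology of the groups $\Gamma^n$. The wreath product $\Gamma\wr\mathfrak{S}_\infty=\Gamma^\infty_e\rtimes\mathfrak{S}_\infty$ carries the product topology; $\Gamma_e^\infty$ and $\mathfrak{S}_\infty$ are regarded as subgroups, and $s(\gamma_1,\gamma_2,\ldots)s^{-1}=(\gamma_{s^{-1}(1)},\gamma_{s^{-1}(2)},\ldots)$. A state on a topological group $G$ is a continuous positive definite function $\varphi$ with $\varphi(e)=1$; it is indecomposable if its GNS-representation $\pi_\varphi$ is a factor-representation, i.e. the $W^*$-algebra $\pi_\varphi(G)''$ is a factor. A state $\varphi$ on $\Gamma\wr\mathfrak{S}_\infty$ is $\mathfrak{S}_\infty$-central if $\varphi(gs)=\varphi(sg)$ for all $g\in\Gamma\wr\mathfrak{S}_\infty$, $s\in\mathfrak{S}_\infty$. Unitary representations $\pi_1,\pi_2$ of $G$ are quasiequivalent if there is a ($*$-)isomorphism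 $\theta:\pi_1(G)''\to\pi_2(G)''$ with $\theta(\pi_1(g))=\pi_2(g)$ for all $g\in G$. *)

(* Defs.v *)
From HB Require Import structures.
From mathcomp Require Import all_boot all_order all_algebra.
From mathcomp Require Import sesquilinear complex.
From mathcomp Require Import all_classical all_reals topology normedtype.

Set Implicit Arguments.
Unset Strict Implicit.
Unset Printing Implicit Defensive.

Import Order.TTheory GRing.Theory Num.Theory.
Import numFieldNormedType.Exports.

Local Open Scope classical_set_scope.
Local Open Scope complex_scope.
Local Open Scope ring_scope.

(* No compatibility between the group law and the topology is required here:
   for a general topological group Gam, multiplication need not be jointly
   continuous for the inductive limit topology on finsupp Gam below. *)
#[short(type="groupTopologicalType")]
HB.structure Definition GroupTopological :=
  {G of monoid.Group G & Topological G}.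

HB.mixin Record GroupTopological_isTopologicalGroup G
    of GroupTopological G := {
  mulg_continuous : continuous (fun p : G * G => (p.1 * p.2)%g) ;
  invg_continuous : continuous (fun x : G => (x^-1)%g)
}.

#[short(type="topologicalGroupType")]
HB.structure Definition TopologicalGroup :=
  {G of GroupTopological G & GroupTopological_isTopologicalGroup G}.

Definition separable (T : topologicalType) : Prop :=
  exists D : set T, countable D /\ dense D.

(* Finitely moved bijections of {1, 2, ...}, relabelled as nat = {0, 1, ...};
   the product is composition and the topology is discrete. *)
Record finperm := FinPerm {
  finperm_fun :> nat -> nat ;
  finperm_inv : nat -> nat ;
  finperm_funK : cancel finperm_fun finperm_inv ;
  finperm_invK : cancel finperm_inv finperm_fun ;
  finperm_finite : finite_set [set i | finperm_fun i != i] }.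

HB.instance Definition _ := gen_eqMixin finperm.
HB.instance Definition _ := gen_choiceMixin finperm.

Lemma finperm_ext (s t : finperm) : s =1 t -> s = t.
Proof.
case: s t => [s s' sK s'K sf] [t t' tK t'K tf] /= /funext est.
have es't' : s' = t'.
  by apply/funext => i; rewrite -{1}(t'K i) -est sK.
by subst t t'; congr FinPerm; exact: Prop_irrelevance.
Qed.

Lemma finperm1_finite : finite_set [set i : nat | id i != i].
Proof.
rewrite (_ : [set _ | _] = set0) //; apply/seteqP; split => // i /=.
by rewrite eqxx.
Qed.

Definition finperm1 : finperm :=
  @FinPerm id id (fun=> erefl) (fun=> erefl) finperm1_finite.

Lemma finpermM_finite (s t : finperm) :
  finite_set [set i | (s \o t) i != i].
Proof.
apply: (@sub_finite_set _ _
  ([set i | s i != i] `|` [set i | t i != i])); last first.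
  by rewrite finite_setU; split; exact: finperm_finite.
move=> i /= sti; have [tii|?] := eqVneq (t i) i; last by right.
by left; move: sti; rewrite /= tii.
Qed.

Definition finpermM (s t : finperm) : finperm :=
  @FinPerm (s \o t) (finperm_inv t \o finperm_inv s)
    (can_comp (@finperm_funK s) (@finperm_funK t))
    (can_comp (@finperm_invK t) (@finperm_invK s)) (finpermM_finite s t).

Lemma finpermV_finite (s : finperm) :
  finite_set [set i | finperm_inv s i != i].
Proof.
apply: sub_finite_set (finperm_finite s) => i /=; apply: contraNN => /eqP e.
by rewrite -{1}e finperm_funK.
Qed.

Definition finpermV (s : finperm) : finperm :=
  @FinPerm (finperm_inv s) s (@finperm_invK s) (@finperm_funK s)
    (finpermV_finite s).

Lemma finpermA : associative finpermM.
Proof. by move=> s t u; apply: finperm_ext. Qed.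
Lemma finperm1M : left_id finperm1 finpermM.
Proof. by move=> s; apply: finperm_ext. Qed.
Lemma finpermM1 : right_id finperm1 finpermM.
Proof. by move=> s; apply: finperm_ext. Qed.
Lemma finpermVM : left_inverse finperm1 finpermV finpermM.
Proof. by move=> s; apply: finperm_ext => i /=; rewrite finperm_funK. Qed.
Lemma finpermMV : right_inverse finperm1 finpermV finpermM.
Proof. by move=> s; apply: finperm_ext => i /=; rewrite finperm_invK. Qed.

HB.instance Definition _ := monoid.isGroup.Build finperm
  finpermA finperm1M finpermM1 finpermVM finpermMV.

HB.instance Definition _ := hasNbhs.Build finperm principal_filter.
HB.instance Definition _ := Discrete_ofNbhs.Build finperm erefl.

Record finsupp (Gam : groupType) := FinSupp {
  finsupp_fun :> nat -> Gam ;
  finsupp_finite : finite_set [set i | finsupp_fun i != 1%g] }.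

HB.instance Definition _ Gam := gen_eqMixin (finsupp Gam).
HB.instance Definition _ Gam := gen_choiceMixin (finsupp Gam).

Section FinSuppGroup.
Variable Gam : groupType.
Implicit Types a b : finsupp Gam.
Local Open Scope group_scope.

Lemma finsupp_ext a b : a =1 b -> a = b.
Proof.
case: a b => [a fa] [b fb] /= /funext eab; subst b.
by congr FinSupp; exact: Prop_irrelevance.
Qed.

Lemma finsupp1_finite : finite_set [set i : nat | (1 : Gam) != 1].
Proof.
rewrite (_ : [set _ | _] = set0) //; apply/seteqP; split => // i /=.
by rewrite eqxx.
Qed.

Definition finsupp1 : finsupp Gam := FinSupp finsupp1_finite.

Lemma finsuppM_finite a b : finite_set [set i | a i * b i != 1].
Proof.
apply: (@sub_finite_set _ _ ([set i | a i != 1] `|` [set i | b i != 1])).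
  move=> i /= abi; have [ai1|?] := eqVneq (a i) 1; last by left.
  by right; move: abi; rewrite ai1 mul1g.
by rewrite finite_setU; split; exact: finsupp_finite.
Qed.

Definition finsuppM a b : finsupp Gam := FinSupp (finsuppM_finite a b).

Lemma finsuppV_finite a : finite_set [set i | (a i)^-1 != 1].
Proof.
apply: sub_finite_set (finsupp_finite a) => i /=.
by apply: contraNN => /eqP ->; rewrite invg1.
Qed.

Definition finsuppV a : finsupp Gam := FinSupp (finsuppV_finite a).

Lemma finsuppA : associative finsuppM.
Proof. by move=> a b c; apply: finsupp_ext => i /=; rewrite mulgA. Qed.
Lemma finsupp1M : left_id finsupp1 finsuppM.
Proof. by move=> a; apply: finsupp_ext => i /=; rewrite mul1g. Qed.
Lemma finsuppM1 : right_id finsupp1 finsuppM.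
Proof. by move=> a; apply: finsupp_ext => i /=; rewrite mulg1. Qed.
Lemma finsuppVM : left_inverse finsupp1 finsuppV finsuppM.
Proof. by move=> a; apply: finsupp_ext => i /=; rewrite mulVg. Qed.
Lemma finsuppMV : right_inverse finsupp1 finsuppV finsuppM.
Proof. by move=> a; apply: finsupp_ext => i /=; rewrite mulgV. Qed.

HB.instance Definition _ := monoid.isGroup.Build (finsupp Gam)
  finsuppA finsupp1M finsuppM1 finsuppVM finsuppMV.

Lemma finsupp_act_finite (s : finperm) a :
  finite_set [set i | a (finperm_inv s i) != 1].
Proof.
apply: (@sub_finite_set _ _ (s @` [set i | a i != 1])).
  by move=> i /= ai; exists (finperm_inv s i) => //; rewrite finperm_invK.
exact: finite_image (finsupp_finite a).
Qed.

Definition finsupp_act (s : finperm) a : finsupp Gam :=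
  FinSupp (finsupp_act_finite s a).

Lemma finsupp_init_finite n (f : 'I_n -> Gam) :
  finite_set [set i : nat | (if insub i is Some j then f j else 1) != 1].
Proof.
apply: sub_finite_set (finite_II n) => i /=.
by case: insubP => // ?; rewrite eqxx.
Qed.

(* The embedding of Gam^n as the first n coordinates. *)
Definition finsupp_init n (f : {ptws 'I_n -> Gam}) : finsupp Gam :=
  FinSupp (finsupp_init_finite f).

End FinSuppGroup.

Section FinSuppTopology.
Variable Gam : topologicalGroupType.

(* The inductive limit topology: {ptws 'I_n -> Gam} carries the product
   topology of Gam^n. *)
Definition finsupp_open (U : set (finsupp Gam)) : Prop :=
  forall n, open (@finsupp_init Gam n @^-1` U).

Lemma finsupp_openT : finsupp_open setT.
Proof. by move=> n; rewrite preimage_setT; exact: openT. Qed.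

Lemma finsupp_openI : setI_closed finsupp_open.
Proof. by move=> U V oU oV n; rewrite preimage_setI; exact: openI. Qed.

Lemma finsupp_open_bigU (I : Type) (f : I -> set (finsupp Gam)) :
  (forall i, finsupp_open (f i)) -> finsupp_open (\bigcup_i f i).
Proof.
move=> of_ n; rewrite preimage_bigcup; apply: bigcup_open => i _.
exact: of_.
Qed.

HB.instance Definition _ := isOpenTopological.Build (finsupp Gam)
  finsupp_openT finsupp_openI finsupp_open_bigU.

End FinSuppTopology.

(* The pair (a, s) stands for the product a s, with a in finsupp Gam and
   s a finitary permutation. *)
Definition wreath (Gam : groupType) : Type := (finsupp Gam * finperm)%type.

HB.instance Definition _ (Gam : groupType) :=
  Choice.copy (wreath Gam) (finsupp Gam * finperm)%type.

Section WreathGroup.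
Variable Gam : groupType.
Implicit Types g h : wreath Gam.
Local Open Scope group_scope.

Definition wreath1 : wreath Gam := (1, 1).
Definition wreathM g h : wreath Gam :=
  (g.1 * finsupp_act g.2 h.1, g.2 * h.2).
Definition wreathV g : wreath Gam :=
  (finsupp_act g.2^-1 g.1^-1, g.2^-1).

Lemma wreathA : associative wreathM.
Proof.
move=> g h k; congr pair; last exact: mulgA.
by apply: finsupp_ext => i /=; rewrite mulgA.
Qed.
Lemma wreath1M : left_id wreath1 wreathM.
Proof.
move=> [a s]; congr pair; last exact: mul1g.
by apply: finsupp_ext => i /=; rewrite mul1g.
Qed.
Lemma wreathM1 : right_id wreath1 wreathM.
Proof.
move=> [a s]; congr pair; last exact: mulg1.
by apply: finsupp_ext => i /=; rewrite mulg1.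
Qed.
Lemma wreathVM : left_inverse wreath1 wreathV wreathM.
Proof.
move=> [a s]; congr pair; last exact: mulVg.
by apply: finsupp_ext => i /=; rewrite mulVg.
Qed.
Lemma wreathMV : right_inverse wreath1 wreathV wreathM.
Proof.
move=> [a s]; congr pair; last exact: mulgV.
by apply: finsupp_ext => i /=; rewrite finperm_invK mulgV.
Qed.

HB.instance Definition _ := monoid.isGroup.Build (wreath Gam)
  wreathA wreath1M wreathM1 wreathVM wreathMV.

Definition wreath_base (a : finsupp Gam) : wreath Gam := (a, 1).
Definition wreath_perm (s : finperm) : wreath Gam := (1, s).

Lemma wreath_decomp g : g = wreath_base g.1 * wreath_perm g.2.
Proof.
case: g => a s; congr pair; last by rewrite /= mul1g.
by apply: finsupp_ext => i /=; rewrite mulg1.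
Qed.

Lemma wreath_conj (s : finperm) (a : finsupp Gam) :
  wreath_perm s * wreath_base a * (wreath_perm s)^-1
  = wreath_base (finsupp_act s a).
Proof.
congr pair; last by rewrite /= mulg1 mulgV.
by apply: finsupp_ext => i /=; rewrite invg1 mulg1 mul1g.
Qed.

End WreathGroup.

HB.instance Definition _ (Gam : topologicalGroupType) :=
  Topological.copy (wreath Gam) (finsupp Gam * finperm)%type.

(* [R[i]^o] is R[i] with the topology of its modulus.  [0 <= z] in R[i] means
   that z is real and nonnegative. *)
Definition positive_definite (R : realType) (G : groupType)
    (phi : G -> R[i]) : Prop :=
  forall (n : nat) (c : 'I_n -> R[i]) (g : 'I_n -> G),
    0 <= \sum_(i < n) \sum_(j < n)
           c i * (c j)^* * phi ((g j)^-1 * g i)%g.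

Definition is_state (R : realType) (G : groupTopologicalType)
    (phi : G -> R[i]) : Prop :=
  [/\ continuous (phi : G -> R[i]^o), positive_definite phi & phi 1%g = 1].

Definition perm_central (R : realType) (Gam : groupType)
    (phi : wreath Gam -> R[i]) : Prop :=
  forall (g : wreath Gam) (s : finperm),
    phi (g * wreath_perm Gam s)%g = phi (wreath_perm Gam s * g)%g.

(* The inner product is linear in its first argument. *)
Record hilbert (R : realType) := Hilbert {
  hilbert_sort :> completeNormedModType R[i] ;
  hdot : {dot hilbert_sort for Num.conj} ;
  hdot_norm : forall x : hilbert_sort, `|x| ^+ 2 = hdot x x }.

Section Operators.
Variables (R : realType) (H : hilbert R).

Definition bounded_operator (T : H -> H) : Prop := linear T /\ continuous T.

Definition adjoint (T T' : H -> H) : Prop :=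
  forall x y : H, hdot H (T x) y = hdot H x (T' y).

Definition commutant (S : set (H -> H)) : set (H -> H) :=
  [set T | bounded_operator T /\ forall A, S A -> T \o A = A \o T].

Definition is_factor (M : set (H -> H)) : Prop :=
  M `&` commutant M = range (fun (c : R[i]) (x : H) => c *: x).

End Operators.

Record star_isomorphism (R : realType) (H1 H2 : hilbert R)
    (M1 : set (H1 -> H1)) (M2 : set (H2 -> H2))
    (theta : (H1 -> H1) -> (H2 -> H2)) : Prop := {
  star_iso_bij : set_bij M1 M2 theta ;
  star_isoD : forall A B, M1 A -> M1 B ->
    theta (A \+ B) = theta A \+ theta B ;
  star_isoZ : forall (c : R[i]) A, M1 A -> theta (c \*: A) = c \*: theta A ;
  star_isoM : forall A B, M1 A -> M1 B -> theta (A \o B) = theta A \o theta B ;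
  star_isoV : forall A A', M1 A -> M1 A' ->
    adjoint A A' -> adjoint (theta A) (theta A') }.

Record unitary_rep (R : realType) (G : groupType) (H : hilbert R) :=
  UnitaryRep {
    rep_fun :> G -> H -> H ;
    rep_linear : forall g, linear (rep_fun g) ;
    rep_dot : forall g x y,
      hdot H (rep_fun g x) (rep_fun g y) = hdot H x y ;
    rep1 : rep_fun 1%g = id ;
    repM : forall g h, rep_fun (g * h)%g = rep_fun g \o rep_fun h }.

Definition rep_vN (R : realType) (G : groupType) (H : hilbert R)
    (pi : unitary_rep G H) : set (H -> H) :=
  commutant (commutant (range pi)).

Definition factor_representation (R : realType) (G : groupType)
    (H : hilbert R) (pi : unitary_rep G H) : Prop :=
  is_factor (rep_vN pi).

Definition quasiequivalent (R : realType) (G : groupType)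
    (H1 H2 : hilbert R) (pi1 : unitary_rep G H1) (pi2 : unitary_rep G H2) :
    Prop :=
  exists theta, star_isomorphism (rep_vN pi1) (rep_vN pi2) theta /\
    forall g, theta (pi1 g) = pi2 g.

Definition cyclic_vector (R : realType) (G : groupType) (H : hilbert R)
    (pi : unitary_rep G H) (xi : H) : Prop :=
  dense [set v : H | exists (n : nat) (c : 'I_n -> R[i]) (g : 'I_n -> G),
    v = \sum_(i < n) c i *: pi (g i) xi].

(* A realization of the GNS construction for phi; it is unique up to unitary
   equivalence.  If phi is continuous then gns_rep is automatically strongly
   continuous. *)
Record gns (R : realType) (G : groupType) (phi : G -> R[i]) := GNS {
  gns_space : hilbert R ;
  gns_rep : unitary_rep G gns_space ;
  gns_vector : gns_space ;
  gns_cyclic : cyclic_vector gns_rep gns_vector ;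
  gns_state : forall g,
    phi g = hdot gns_space (gns_rep g gns_vector) gns_vector }.

(* By uniqueness of the GNS construction, one realization is a factor
   representation if and only if all are. *)
Definition indecomposable (R : realType) (G : groupType)
    (phi : G -> R[i]) : Prop :=
  forall D : gns phi, factor_representation (gns_rep D).

(* Main.v *)
Require Import Defs.
From mathcomp Require Import all_boot all_order all_algebra.
From mathcomp Require Import sesquilinear complex.
From mathcomp Require Import all_classical all_reals topology normedtype.
From mathcomp Require Import sequences.
From mathcomp Require Import ring lra.

Set Implicit Arguments.
Unset Strict Implicit.
Unset Printing Implicit Defensive.

Import Order.TTheory GRing.Theory Num.Theory.
Import numFieldNormedType.Exports.
Import ComplexField.Normc.

Local Open Scope classical_set_scope.
Local Open Scope complex_scope.
Local Open Scope ring_scope.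

(** Fix [g] in the wreath product, let [d] bound its support, and let [g_n] be
the copy of [g] obtained by conjugating with the permutation that exchanges the
blocks of indices [0, d) and [n d, (n + 1) d).  Any element [h] has finite
support, so [g_n] commutes with [h] as soon as [n] is large.  Hence a limit of
operators built from the far copies [pi (g_n)] commutes with the whole
representation and lies in its von Neumann algebra; in a factor representation
it is a scalar.  Since conjugating by a permutation does not change a central
state, that scalar is [phi g].

The limit is taken in the strong topology, along the averages [T_k] of
[pi (g_n)] over the dyadic blocks [2^k <= n < 2^(k+1)].  By centrality the
vectors [pi (g_n) (pi a xi)] are exchangeable for large [n] ([exchangeable]):
their Gram matrix is constant off the diagonal.  Averages of such vectors over
disjoint blocks form a Cauchy sequence ([exchangeable_mean_cvg]), and this
gives [T_k x --> phi g *: x] for all [x] ([average_copy_strong_limit]).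

A quasi-equivalence [theta] sends [T_k] for [phi1] to [T_k] for [phi2], so it
remains to see that a *-isomorphism of von Neumann algebras respects scalar
strong limits.  It does because it preserves order.  Set
[L_k = 1 - ((T_k - c) / 2)^* ((T_k - c) / 2)] with [c = phi1 g]: these are
commuting symmetric contractions, with [L_k --> 1] on the first space and
[theta L_k --> r] on the second, where [r = 1 - |phi2 g - phi1 g|^2 / 4].  Along
a fast subsequence, the squared products [(L_(f 0) ... L_(f m))^2] decrease to
an operator [P <> 0] of the first algebra.  If [r < 1], the images of these
products tend strongly to [0].  But [theta] maps positive operators to positive
ones, a positive operator being a square in its algebra ([square_root]).  So
[0 <= theta P <= theta (products squared) --> 0], whence [theta P = 0] and
[P = 0].  This contradiction shows [r = 1] ([star_iso_strong_limit]), that is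
[phi1 g = phi2 g]. *)

(** * The real geometry of a complex Hilbert space *)

Section Hilbert.
Variables (R : realType) (H : hilbert R).
Implicit Types (x y z : H) (c : R[i]) (r : R).

(** Estimates are made between real numbers; [hdotE] recovers the complex inner
product from its real part. *)
Definition rdot x y : R := complex.Re (hdot H x y).
Definition nrm x : R := complex.Re `|x|.

Lemma nrmE x : `|x| = (nrm x)%:C.
Proof.
have := normr_ge0 x; rewrite lecE /nrm.
by case: `|x| => a b /= /andP[/eqP -> _].
Qed.

Let ReD (a b : R[i]) : complex.Re (a + b) = complex.Re a + complex.Re b.
Proof. by case: a b => [a a'] [b b']. Qed.

Let ReN (a : R[i]) : complex.Re (- a) = - complex.Re a.
Proof. by case: a. Qed.

Let ReZ (a : R) (b : R[i]) : complex.Re (a%:C * b) = a * complex.Re b.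
Proof. by case: b => b b' /=; rewrite mul0r subr0. Qed.

Lemma hdotC x y : hdot H x y = (hdot H y x)^*.
Proof. by rewrite hermC expr0 mul1r. Qed.

Lemma rdotC x y : rdot x y = rdot y x.
Proof. by rewrite /rdot hdotC; case: (hdot H y x). Qed.

Lemma nrm_ge0 x : 0 <= nrm x.
Proof. by rewrite -lecR -nrmE normr_ge0. Qed.

Lemma nrm_sqr x : nrm x ^+ 2 = rdot x x.
Proof.
apply: complexI; rewrite rmorphXn /= -nrmE hdot_norm.
by rewrite /rdot -hdot_norm nrmE -rmorphXn.
Qed.

Lemma nrmD x y : nrm (x + y) <= nrm x + nrm y.
Proof. by rewrite -lecR rmorphD /= -!nrmE ler_normD. Qed.

Lemma nrmN x : nrm (- x) = nrm x.
Proof. by rewrite /nrm normrN. Qed.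

Lemma nrmBC x y : nrm (x - y) = nrm (y - x).
Proof. by rewrite -nrmN opprB. Qed.

Lemma nrmZ c x : nrm (c *: x) = normc c * nrm x.
Proof. by apply: complexI; rewrite rmorphM /= -!nrmE normrZ. Qed.

Lemma nrmZr r x : nrm (r%:C *: x) = `|r| * nrm x.
Proof. by rewrite nrmZ /= expr0n /= addr0 sqrtr_sqr. Qed.

Lemma nrm0_eq0 x : nrm x = 0 -> x = 0.
Proof. by move=> h; apply/normr0_eq0; rewrite nrmE h. Qed.

Lemma nrm0 : nrm (0 : H) = 0.
Proof. by rewrite /nrm normr0. Qed.

Lemma rdotDl x y z : rdot (x + y) z = rdot x z + rdot y z.
Proof. by rewrite /rdot linearDl ReD. Qed.

Lemma rdotDr x y z : rdot z (x + y) = rdot z x + rdot z y.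
Proof. by rewrite !(rdotC z) rdotDl. Qed.

Lemma rdotNl x z : rdot (- x) z = - rdot x z.
Proof. by rewrite /rdot linearNl ReN. Qed.

Lemma rdotNr x z : rdot z (- x) = - rdot z x.
Proof. by rewrite !(rdotC z) rdotNl. Qed.

Lemma rdot0l z : rdot 0 z = 0.
Proof. by rewrite -[0 : H](addrN 0) rdotDl rdotNl subrr. Qed.

Lemma rdot0r z : rdot z 0 = 0.
Proof. by rewrite rdotC rdot0l. Qed.

Lemma rdotZl r x z : rdot (r%:C *: x) z = r * rdot x z.
Proof. by rewrite /rdot linearZl_LR ReZ. Qed.

Lemma rdotZr r x z : rdot z (r%:C *: x) = r * rdot z x.
Proof. by rewrite !(rdotC z) rdotZl. Qed.

Lemma rdot_sumr I (s : seq I) (F : I -> H) z :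
  rdot z (\sum_(i <- s) F i) = \sum_(i <- s) rdot z (F i).
Proof.
elim: s => [|i s IH]; last by rewrite !big_cons rdotDr IH.
by rewrite !big_nil rdot0r.
Qed.

Lemma rdot_suml I (s : seq I) (F : I -> H) z :
  rdot (\sum_(i <- s) F i) z = \sum_(i <- s) rdot (F i) z.
Proof. by rewrite rdotC rdot_sumr; apply: eq_bigr => i _; rewrite rdotC. Qed.

Lemma hdotE x y : hdot H x y = rdot x y +i* rdot x ('i%C *: y).
Proof.
rewrite /rdot linearZr_LR /=; case: (hdot H x y) => a b /=.
by congr (_ +i* _); rewrite !mul0r mulN1r sub0r opprK.
Qed.

Lemma nrmB_sqr x y : nrm (x - y) ^+ 2 = nrm x ^+ 2 - 2 * rdot x y + nrm y ^+ 2.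
Proof. by rewrite !nrm_sqr rdotDl !rdotDr !rdotNl !rdotNr (rdotC y x); ring. Qed.

Lemma rdot_le x y : rdot x y <= nrm x * nrm y.
Proof.
have [h|h] := eqVneq (nrm x) 0.
  by rewrite (nrm0_eq0 h) rdot0l mulr_ge0 ?nrm_ge0.
have h0 : 0 < nrm x by rewrite lt_neqAle eq_sym h nrm_ge0.
have := sqr_ge0 (nrm ((nrm y)%:C *: x - (nrm x)%:C *: y)).
rewrite nrmB_sqr !nrmZr rdotZl rdotZr !ger0_norm ?nrm_ge0//.
rewrite (_ : _ + _ = 2 * nrm x * nrm y * (nrm x * nrm y - rdot x y)); last by ring.
have [h'|h'] := eqVneq (nrm y) 0.
  by move=> _; rewrite (nrm0_eq0 h') rdot0r nrm0 mulr0.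
have h0' : 0 < nrm y by rewrite lt_neqAle eq_sym h' nrm_ge0.
by rewrite pmulr_rge0 ?subr_ge0 // !mulr_gt0.
Qed.

Lemma cvg_nrmP (u : nat -> H) (l : H) :
  u @ \oo --> l <->
  (forall e : R, 0 < e -> exists N, forall n, (N <= n)%N -> nrm (u n - l) < e).
Proof.
split=> [/cvgrPdist_lt h e e0|h].
  have := h e%:C; rewrite ltcR => /(_ e0) [N _ hN]; exists N => n Nn.
  by have := hN n Nn; rewrite /= nrmE ltcR (nrmBC l).
apply/cvgrPdist_lt => e e0; have [e1 e1E] : exists e1, e = e1%:C.
  by move: e0; rewrite ltcE; case: e => a b /= /andP[/eqP -> _]; exists a.
move: e0; rewrite e1E ltcR => /h[N hN]; exists N => // n Nn.
by rewrite /= nrmE ltcR (nrmBC l) hN.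
Qed.

Lemma cauchy_nrm (u : nat -> H) :
  (forall e : R, 0 < e -> exists N, forall n m, (N <= n)%N -> (N <= m)%N ->
     nrm (u n - u m) < e) -> exists l : H, u @ \oo --> l.
Proof.
move=> h; suff /cauchy_cvgP : cauchy (u x @[x --> \oo]).
  by move=> ul; exists (lim (u x @[x --> \oo])).
apply/cauchy_ballP => e e0; have [e1 e1E] : exists e1, e = e1%:C.
  by move: e0; rewrite ltcE; case: e => a b /= /andP[/eqP -> _]; exists a.
move: e0; rewrite e1E ltcR => /h[N hN].
have tail : (u x @[x --> \oo]) (u @` [set n | (N <= n)%N]).
  by exists N => // n Nn; exists n.
exists (u @` [set n | (N <= n)%N], u @` [set n | (N <= n)%N]); first by split.
by move=> [_ _] [[n /= Nn <-] [m /= Nm <-]]; rewrite -ball_normE /= nrmE ltcR hN.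
Qed.

Lemma cvg_nrm_dominated (u v : nat -> H) (l k : H) r :
  u @ \oo --> l -> (forall n, nrm (v n - k) <= r * nrm (u n - l)) -> v @ \oo --> k.
Proof.
move=> /cvg_nrmP ul uv; apply/cvg_nrmP => e e0.
have r0 : 0 < `|r| + 1 by rewrite ltr_wpDl.
have [N hN] := ul _ (divr_gt0 e0 r0); exists N => n /hN.
rewrite ltr_pdivlMr// mulrC; apply: le_lt_trans; apply: le_trans (uv n) _.
by rewrite ler_wpM2r ?nrm_ge0// (le_trans (ler_norm r))// lerDl.
Qed.

Lemma cvg_nrm (u : nat -> H) (l : H) : u @ \oo --> l -> forall b,
  (forall n, nrm (u n) <= b) -> nrm l <= b.
Proof.
move=> /cvg_nrmP ul b ub; apply/ler_addgt0Pl => e /ul [N /(_ N (leqnn _)) hN].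
rewrite -(subrK (u N) l); apply: le_trans (nrmD _ _) _.
by rewrite lerD// nrmBC ltW.
Qed.

Lemma cvg_rdotl (u : nat -> H) (l y : H) : u @ \oo --> l ->
  rdot (u n) y @[n --> \oo] --> rdot l y.
Proof.
move=> /cvg_nrmP ul; apply/cvgrPdist_lt => e e0.
have y0 : 0 < nrm y + 1 by rewrite ltr_wpDl ?nrm_ge0.
have [N hN] := ul _ (divr_gt0 e0 y0); exists N => // n /= /hN.
rewrite ltr_pdivlMr// => /(le_lt_trans _); apply.
have : nrm (u n - l) * nrm y <= nrm (u n - l) * (nrm y + 1).
  by rewrite ler_wpM2l ?nrm_ge0// lerDl.
apply: le_trans; rewrite -rdotNl -rdotDl ler_norml; apply/andP; split.
  by rewrite lerNl -rdotNl opprB rdot_le.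
by rewrite nrmBC rdot_le.
Qed.

Lemma dense_nrm (S : set H) x (e : R) : dense S -> 0 < e ->
  exists2 v, S v & nrm (v - x) < e.
Proof.
move=> dS e0; have e0C : 0 < e%:C :> R[i] by rewrite ltcR.
have [v [xv Sv]] := dS _ (ex_intro _ x (ballxx x e0C)) (ball_open x _).
have {}xv : ball x e%:C v by [].
by exists v => //; move: xv; rewrite -ball_normE /= nrmE ltcR nrmBC.
Qed.

End Hilbert.

Arguments cvg_rdotl {R H u l} y _.

(** * Strong limits of operators *)

Section StrongLimits.
Variables (R : realType) (H : hilbert R).
Implicit Types (x y z : H) (c : R[i]) (r : R) (T : H -> H) (A : nat -> H -> H).

Definition contractive T := forall x, nrm (T x) <= nrm x.
Definition self_adjoint T := forall x y, rdot (T x) y = rdot x (T y).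
Definition strong_limit A T := forall x, A n x @[n --> \oo] --> T x.

Lemma linB T x y : linear T -> T (x - y) = T x - T y.
Proof. by move=> lT; rewrite -[- y]scaleN1r addrC lT /= scaleN1r [LHS]addrC. Qed.

Lemma linD T x y : linear T -> T (x + y) = T x + T y.
Proof. by move=> lT; rewrite -[x in LHS]scale1r lT scale1r. Qed.

Lemma lin0 T : linear T -> T 0 = 0.
Proof. by move=> lT; rewrite -[in LHS](subrr (0 : H)) linB// subrr. Qed.

Lemma linZ T c x : linear T -> T (c *: x) = c *: T x.
Proof. by move=> lT; rewrite -[_ *: x in LHS]addr0 lT /= lin0// addr0. Qed.

Lemma lipschitz_bounded T r :
  linear T -> (forall x, nrm (T x) <= r * nrm x) -> bounded_operator T.
Proof.
move=> lT bT; split=> // x; apply/cvgrPdist_lt => e e0.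
have [e1 e1E] : exists e1, e = e1%:C.
  by move: e0; rewrite ltcE; case: e => a b /= /andP[/eqP -> _]; exists a.
move: e0; rewrite e1E ltcR => e0.
have r0 : 0 < `|r| + 1 by rewrite ltr_wpDl.
near=> t; rewrite -linB// nrmE ltcR; apply: le_lt_trans (bT _) _.
have h : nrm (x - t) < e1 / (`|r| + 1).
  by rewrite -ltcR -nrmE; near: t; apply: cvgr_dist_lt; rewrite ?ltcR ?divr_gt0.
move: h; rewrite ltr_pdivlMr// mulrC; apply: le_lt_trans.
by rewrite ler_wpM2r ?nrm_ge0// (le_trans (ler_norm r))// lerDl.
Unshelve. all: by end_near. Qed.

Lemma contractive_bounded T : linear T -> contractive T -> bounded_operator T.
Proof. by move=> lT cT; apply: (@lipschitz_bounded T 1) => // x; rewrite mul1r. Qed.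

Lemma self_adjointP T : linear T -> self_adjoint T -> adjoint T T.
Proof. by move=> lT sT x y; rewrite !hdotE !sT linZ. Qed.

Lemma adjoint_selfP T : adjoint T T -> self_adjoint T.
Proof. by move=> aT x y; rewrite /rdot aT. Qed.

Lemma strong_limit_linear A T :
  (forall n, linear (A n)) -> strong_limit A T -> linear T.
Proof.
move=> lA AT c x y; apply: norm_cvg_unique (AT _) _.
have -> : (fun n => A n (c *: x + y)) = (fun n => c *: A n x + A n y).
  by apply/funext => n; exact: lA.
by apply: cvgD; [apply: cvgZr|]; apply: AT.
Qed.

Lemma strong_limit_contractive A T :
  (forall n, contractive (A n)) -> strong_limit A T -> contractive T.
Proof. by move=> cA AT x; apply: cvg_nrm (AT x) _ _ => n; apply: cA. Qed.

Lemma strong_limit_self_adjoint A T :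
  (forall n, self_adjoint (A n)) -> strong_limit A T -> self_adjoint T.
Proof.
move=> sA AT x y; apply: (cvg_unique (@norm_hausdorff R R^o) (cvg_rdotl y (AT x))).
have -> : (fun n => rdot (A n x) y) = (fun n => rdot (A n y) x).
  by apply/funext => n; rewrite sA rdotC.
by rewrite rdotC; apply: cvg_rdotl.
Qed.

(** Joint strong continuity of evaluation: it holds because the [A n] are
uniformly Lipschitz, and it makes products of strong limits converge. *)
Lemma strong_limit_apply A T (u : nat -> H) l :
  (forall n, linear (A n)) -> (forall n, contractive (A n)) ->
  strong_limit A T -> u @ \oo --> l -> A n (u n) @[n --> \oo] --> T l.
Proof.
move=> lA cA AT ul; rewrite -[T l]add0r.
have -> : (fun n => A n (u n)) = (fun n => A n (u n - l) + A n l).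
  by apply/funext => n; rewrite -linD// subrK.
apply: cvgD; last exact: AT.
have u0 : (fun n => u n - l) @ \oo --> (0 : H).
  by rewrite -(subrr l); apply: cvgB ul _; apply: cvg_cst.
by apply: (@cvg_nrm_dominated _ _ _ _ _ _ 1 u0) => n; rewrite !subr0 mul1r; apply: cA.
Qed.

(** For [0 <= T <= 1] the difference [T - T^2 = T (1 - T) T + (1 - T) T (1 - T)]
is positive. *)
Lemma positive_contractive_sqr T x : linear T -> self_adjoint T ->
  (forall x, 0 <= rdot (T x) x <= rdot x x) -> nrm (T x) ^+ 2 <= rdot (T x) x.
Proof.
move=> lT sT pT; have /andP[_ h1] := pT (T x).
have /andP[h2 _] := pT (x - T x).
move: h2 h1; rewrite linB// !rdotDl !rdotDr !rdotNl !rdotNr nrm_sqr.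
rewrite (sT (T x) x); lra.
Qed.

Lemma positive_contractive T : linear T -> self_adjoint T ->
  (forall x, 0 <= rdot (T x) x <= rdot x x) -> contractive T.
Proof.
move=> lT sT pT x; rewrite -ler_sqr ?nnegrE ?nrm_ge0//.
apply: le_trans (positive_contractive_sqr x lT sT pT) _.
by rewrite nrm_sqr; have /andP[] := pT x.
Qed.

(** Monotone convergence.  For [n <= m] the difference [A m - A n] lies between
[0] and [1], so [positive_contractive_sqr] bounds [|A m x - A n x|^2] by the
increment of the bounded monotone real sequence [rdot (A n x) x]. *)
Lemma increasing_strong_limit A :
  (forall n, linear (A n)) -> (forall n, self_adjoint (A n)) ->
  (forall n x, 0 <= rdot (A n x) x <= rdot x x) ->
  (forall n x, rdot (A n x) x <= rdot (A n.+1 x) x) ->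
  exists T, [/\ linear T, self_adjoint T, strong_limit A T &
    forall n x, rdot (A n x) x <= rdot (T x) x <= rdot x x].
Proof.
move=> lA sA pA iA.
have mono n m x : (n <= m)%N -> rdot (A n x) x <= rdot (A m x) x.
  elim: m => [|m IH]; first by rewrite leqn0 => /eqP ->.
  by rewrite leq_eqVlt => /predU1P[->//|/IH]; move/le_trans; apply; apply: iA.
have dist n m x : (n <= m)%N ->
    nrm (A m x - A n x) ^+ 2 <= rdot (A m x) x - rdot (A n x) x.
  move=> nm; rewrite -rdotNl -rdotDl.
  apply: (@positive_contractive_sqr (fun x => A m x - A n x)).
  - by move=> c y z; rewrite !lA scalerBr opprD addrACA.
  - by move=> y z; rewrite rdotDl rdotDr rdotNl rdotNr !sA.
  - move=> z; rewrite rdotDl rdotNl; have := mono _ _ z nm.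
    by have /andP[] := pA n z; have /andP[] := pA m z; lra.
have lim_x x : exists l : H, A n x @[n --> \oo] --> l.
  apply: cauchy_nrm => e e0.
  pose E := range (fun n => rdot (A n x) x).
  have supE : has_sup E.
    split; first by exists (rdot (A 0%N x) x), 0%N.
    by exists (rdot x x) => _ [n _ <-]; have /andP[] := pA n x.
  have e20 : 0 < (e / 2) ^+ 2 by rewrite exprn_gt0// divr_gt0.
  have [_ [N _ <-] hN] := sup_adherent e20 supE.
  have near_N n : (N <= n)%N -> nrm (A n x - A N x) < e / 2.
    move=> Nn; rewrite -ltr_sqr ?nnegrE ?nrm_ge0 ?divr_ge0 ?(ltW e0)//.
    apply: le_lt_trans (dist _ _ _ Nn) _.
    have : rdot (A n x) x <= sup E by apply: sup_upper_bound => //; exists n.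
    lra.
  exists N => n m /near_N h /near_N h'.
  rewrite -(subrK (A N x) (A n x)) -addrA; apply: le_lt_trans (nrmD _ _) _.
  by rewrite (splitr e) ltrD// nrmBC.
have [T AT] := choice lim_x.
exists T; split=> //.
- exact: strong_limit_linear AT.
- exact: strong_limit_self_adjoint AT.
move=> n x; apply/andP; split.
  by apply: cvgr_to_ge (cvg_rdotl x (AT x)) _; exists n => // m; apply: mono.
apply: cvgr_to_le (cvg_rdotl x (AT x)) _; exists 0%N => // m _.
by have /andP[] := pA m x.
Qed.
End StrongLimits.

(** * Square roots and commutants *)

Section SquareRoot.
Variables (R : realType) (H : hilbert R).
Implicit Types (x y z : H) (c : R[i]) (r : R) (T D : H -> H).

(** Polynomials in [D] with nonnegative coefficients: if [D >= 0] then all of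
them are positive, and unlike general positive operators they are visibly
stable under composition. *)
Inductive poscone D : (H -> H) -> Prop :=
| poscone_iter k : poscone D (iter k D)
| poscone_add T T' : poscone D T -> poscone D T' -> poscone D (fun x => T x + T' x)
| poscone_scale r T : 0 <= r -> poscone D T -> poscone D (fun x => r%:C *: T x).

Lemma poscone_linear D T : linear D -> poscone D T -> linear T.
Proof.
move=> lD; elim=> [k|{}T T' _ lT _ lT'|r {}T _ _ lT] c x y.
- by elim: k => //= k ->; rewrite lD.
- by rewrite lT lT' scalerDr addrACA.
- by rewrite lT scalerDr !scalerA mulrC.
Qed.

Lemma poscone_comp D T T' : linear D ->
  poscone D T -> poscone D T' -> poscone D (T \o T').
Proof.
move=> lD; elim=> [k|T1 T2 _ h1 _ h2|r T1 r0 _ h1] pT'.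
- elim: pT' => [j|T1 T2 _ h1 _ h2|r T1 r0 _ h1].
  + rewrite (_ : _ \o _ = iter (k + j) D); first exact: poscone_iter.
    by apply/funext => x; rewrite iterD.
  + rewrite (_ : _ \o _ = fun x => (iter k D \o T1) x + (iter k D \o T2) x).
      exact: poscone_add.
    apply/funext => x /=; rewrite linD//.
    exact: poscone_linear lD (@poscone_iter D k).
  + rewrite (_ : _ \o _ = fun x => r%:C *: (iter k D \o T1) x).
      exact: poscone_scale.
    apply/funext => x /=; rewrite linZ//.
    exact: poscone_linear lD (@poscone_iter D k).
- exact: poscone_add (h1 pT') (h2 pT').
- exact: poscone_scale r0 (h1 pT').
Qed.

Lemma poscone_self_adjoint D T : self_adjoint D -> poscone D T -> self_adjoint T.
Proof.
move=> sD; elim=> [k|{}T T' _ h _ h'|r {}T r0 _ h] x y.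
- by elim: k x y => // k IH x y; rewrite iterS iterSr sD IH.
- by rewrite rdotDl rdotDr h h'.
- by rewrite rdotZl rdotZr h.
Qed.

(** An even power of [D] is [D^j D^j], an odd one is [D^j D D^j]. *)
Lemma poscone_ge0 D T x : self_adjoint D -> (forall x, 0 <= rdot (D x) x) ->
  poscone D T -> 0 <= rdot (T x) x.
Proof.
move=> sD pD pT; elim: pT x => [k|{}T T' _ h _ h'|r {}T r0 _ h] x.
- have [h _] : (forall x, 0 <= rdot (iter k D x) x) /\
               (forall x, 0 <= rdot (iter k.+1 D x) x).
    elim: k => [|k [IH IH']]; first by split=> // z; rewrite -nrm_sqr sqr_ge0.
    by split=> // z; rewrite iterS iterSr sD; apply: IH.
  exact: h.
- by rewrite rdotDl addr_ge0.
- by rewrite rdotZl mulr_ge0.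
Qed.

(** The iteration for [1 - sqrt (1 - D)], whose fixed points satisfy
[(1 - Y)^2 = 1 - D]. *)
Fixpoint sqrt_approx D n : H -> H :=
  if n is n'.+1 then
    fun x => (2^-1)%:C *: (D x + sqrt_approx D n' (sqrt_approx D n' x))
  else fun x => 0%:C *: x.

Arguments sqrt_approx : simpl never.

Lemma sqrt_approx0 D x : sqrt_approx D 0 x = 0.
Proof. by rewrite /sqrt_approx scale0r. Qed.

Lemma sqrt_approxS D n x : sqrt_approx D n.+1 x =
  (2^-1)%:C *: (D x + sqrt_approx D n (sqrt_approx D n x)).
Proof. by []. Qed.

Lemma sqrt_approx_poscone D n : linear D -> poscone D (sqrt_approx D n).
Proof.
move=> lD; elim: n => [|n IH] /=.
  exact: poscone_scale (lexx _) (@poscone_iter D 0).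
apply: poscone_scale; first by rewrite invr_ge0.
by apply: poscone_add (@poscone_iter D 1) _; apply: poscone_comp.
Qed.

(** The increments stay in the cone by induction: if [Y' = Y + W] then
[Y'^2 - Y^2 = Y W + W Y']. *)
Lemma sqrt_approx_step D n : linear D -> exists2 W, poscone D W &
  forall x, sqrt_approx D n.+1 x = sqrt_approx D n x + W x.
Proof.
move=> lD; elim: n => [|n [W pW WE]].
  exists (fun x => (2^-1)%:C *: iter 1 D x).
    by apply: poscone_scale; [rewrite invr_ge0|apply: poscone_iter].
  by move=> x; rewrite sqrt_approxS !sqrt_approx0 addr0 add0r.
have pY m := sqrt_approx_poscone m lD.
exists (fun x => (2^-1)%:C *: ((sqrt_approx D n \o W) x + (W \o sqrt_approx D n.+1) x)).
  apply: poscone_scale; first by rewrite invr_ge0.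
  by apply: poscone_add; apply: poscone_comp.
move=> x /=; have h0 := sqrt_approxS D n x; have h1 := sqrt_approxS D n.+1 x.
have lY := poscone_linear lD (pY n); move: WE h0 h1 lY {pY}.
move: (sqrt_approx D n.+2) (sqrt_approx D n.+1) (sqrt_approx D n).
move=> Y2 Y1 Y0 WE h0 -> lY; rewrite [X in _ = X + _]h0 -scalerDr; congr (_ *: _).
by rewrite !WE (linD _ _ lY) !addrA.
Qed.

Lemma sqrt_approx_contractive D n : contractive D -> contractive (sqrt_approx D n).
Proof.
move=> cD; elim: n => [|n IH] x; first by rewrite sqrt_approx0 nrm0 nrm_ge0.
rewrite sqrt_approxS.
rewrite nrmZr ger0_norm ?invr_ge0//.
have := nrmD (D x) (sqrt_approx D n (sqrt_approx D n x)).
have := cD x; have := le_trans (IH _) (IH x). lra.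
Qed.

(** The root [B = 1 - Y] is produced together with polynomials in [1 - T]
approximating it strongly, so that it belongs to every von Neumann algebra
containing [T]. *)
Lemma square_root T : linear T -> self_adjoint T ->
  (forall x, 0 <= rdot (T x) x <= rdot x x) ->
  exists B A, [/\ linear B, self_adjoint B, B \o B = T &
    (forall n, poscone (fun x => x - T x) (A n)) /\
    strong_limit (fun n x => x - A n x) B].
Proof.
move=> lT sT pT; pose D x := x - T x.
have lD : linear D by move=> c x y; rewrite /D lT scalerBr opprD addrACA.
have sD : self_adjoint D.
  by move=> x y; rewrite /D rdotDl rdotDr rdotNl rdotNr sT.
have pD x : 0 <= rdot (D x) x <= rdot x x.
  by rewrite /D rdotDl rdotNl; have /andP[] := pT x; lra.
have cD := positive_contractive lD sD pD.
have pY n := sqrt_approx_poscone n lD.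
have lY n := poscone_linear lD (pY n).
have sY n := poscone_self_adjoint sD (pY n).
have cY n := @sqrt_approx_contractive D n cD.
have D0 x : 0 <= rdot (D x) x by have /andP[] := pD x.
have [n x|n x|Y [lY' sY' YY _]] := increasing_strong_limit lY sY.
- rewrite (poscone_ge0 _ sD D0 (pY n)) -nrm_sqr expr2.
  by apply: le_trans (rdot_le _ _) _; rewrite ler_wpM2r ?nrm_ge0//; apply: cY.
- have [W pW ->] := sqrt_approx_step n lD.
  by rewrite rdotDl lerDl (poscone_ge0 _ sD D0 pW).
have YE x : Y x = (2^-1)%:C *: (D x + Y (Y x)).
  have h := YY x; rewrite -cvg_shiftS in h.
  apply: norm_cvg_unique h _; apply: cvgZr; apply: cvgD; first exact: cvg_cst.
  exact: strong_limit_apply lY cY YY (YY x).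
exists (fun x => x - Y x), (sqrt_approx D); split.
- by move=> c x y; rewrite lY' scalerBr opprD addrACA.
- by move=> x y; rewrite rdotDl rdotDr rdotNl rdotNr sY'.
- apply/funext => x /=; rewrite linB//.
  have : (2%:C : R[i]) *: Y x = D x + Y (Y x).
    by rewrite [in LHS]YE scalerA -rmorphM /= divff ?pnatr_eq0// scale1r.
  rewrite /D (_ : 2%:C = 1 + 1) ?rmorphD// scalerDl !scale1r => h.
  have -> : Y (Y x) = Y x + Y x - (x - T x) by rewrite h addrC addKr.
  by rewrite !opprD !opprK !addrA !subrK subrr add0r.
- by split=> // x; apply: cvgB (YY x); apply: cvg_cst.
Qed.

End SquareRoot.

Section Commutants.
Variables (R : realType) (H : hilbert R).
Implicit Types (S : set (H -> H)) (T B : H -> H).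

Lemma bounded_id : bounded_operator (id : H -> H).
Proof. by apply: contractive_bounded. Qed.

Lemma bounded_add T T' : bounded_operator T -> bounded_operator T' ->
  bounded_operator (T \+ T').
Proof.
move=> [lT cT] [lT' cT']; split=> [c x y|x].
  by rewrite /= lT lT' scalerDr addrACA.
exact: cvgD (cT x) (cT' x).
Qed.

Lemma bounded_scale (c : R[i]) T : bounded_operator T -> bounded_operator (c \*: T).
Proof.
move=> [lT cT]; split=> [d x y|x]; last exact: cvgZr (cT x).
by rewrite /= lT scalerDr !scalerA mulrC.
Qed.

Lemma bounded_comp T T' : bounded_operator T -> bounded_operator T' ->
  bounded_operator (T \o T').
Proof.
move=> [lT cT] [lT' cT']; split=> [d x y|x]; first by rewrite /= lT' lT.
by apply: continuous_comp; [apply: cT'|apply: cT].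
Qed.

Variable S : set (H -> H).
Hypothesis Sb : forall A, S A -> bounded_operator A.

Lemma commutant_apply T A x : commutant S T -> S A -> T (A x) = A (T x).
Proof. by move=> [_ h] /h /(congr1 (@^~ x)). Qed.

Lemma commutant_id : commutant S id.
Proof. by split=> //; apply: bounded_id. Qed.

Lemma commutant_add T T' : commutant S T -> commutant S T' -> commutant S (T \+ T').
Proof.
move=> hT hT'; split; first exact: bounded_add hT.1 hT'.1.
move=> A SA; apply/funext => x /=; have [lA _] := Sb SA.
by rewrite linD// (commutant_apply _ hT SA) (commutant_apply _ hT' SA).
Qed.

Lemma commutant_scale (c : R[i]) T : commutant S T -> commutant S (c \*: T).
Proof.
move=> hT; split; first exact: bounded_scale hT.1.
move=> A SA; apply/funext => x /=; have [lA _] := Sb SA.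
by rewrite linZ// (commutant_apply _ hT SA).
Qed.

Lemma commutant_comp T T' : commutant S T -> commutant S T' -> commutant S (T \o T').
Proof.
move=> hT hT'; split; first exact: bounded_comp hT.1 hT'.1.
move=> A SA; apply/funext => x /=.
by rewrite (commutant_apply _ hT' SA) (commutant_apply _ hT SA).
Qed.

Lemma commutant_sub T T' : commutant S T -> commutant S T' ->
  commutant S (T \+ (-1 \*: T')).
Proof. by move=> sT sT'; apply/commutant_add/commutant_scale. Qed.

Lemma commutant_strong_limit (A : nat -> H -> H) T :
  (forall n, commutant S (A n)) -> strong_limit A T -> bounded_operator T ->
  commutant S T.
Proof.
move=> SA AT bT; split=> // B SB; apply/funext => x /=; have [_ cB] := Sb SB.
apply: norm_cvg_unique (AT (B x)) _.
have -> : (fun n => A n (B x)) = (fun n => B (A n x)).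
  by apply/funext => n; rewrite (commutant_apply _ (SA n) SB).
by apply: continuous_cvg; [exact: cB|exact: AT].
Qed.

End Commutants.

(** * *-isomorphisms and scalar strong limits *)

Section StarIsomorphisms.
Variables (R : realType) (H1 H2 : hilbert R).
Variables (S1 : set (H1 -> H1)) (S2 : set (H2 -> H2)).
Hypothesis S1b : forall A, S1 A -> bounded_operator A.
Local Notation M1 := (commutant S1).
Local Notation M2 := (commutant S2).
Variable theta : (H1 -> H1) -> (H2 -> H2).
Hypothesis isoT : star_isomorphism M1 M2 theta.

Lemma poscone_commutant (D T : H1 -> H1) : M1 D -> poscone D T -> M1 T.
Proof.
move=> SD; elim=> [k|{}T T' _ h _ h'|r {}T r0 _ h].
- elim: k => [|k IH]; first exact: commutant_id.
  exact: (commutant_comp SD IH).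
- exact: commutant_add.
- exact: commutant_scale.
Qed.

(** Positivity of [theta T], in the form used below: the root of [T] lies in the
algebra, and its image is a symmetric root of [theta T]. *)
Lemma star_iso_square (T : H1 -> H1) : M1 T -> self_adjoint T ->
  (forall x, 0 <= rdot (T x) x <= rdot x x) ->
  exists B : H2 -> H2, [/\ M2 B, self_adjoint B & theta T = B \o B].
Proof.
move=> MT sT pT; have [[lT _] _] := MT.
have [B [A [lB sB BB [pA AB]]]] := square_root lT sT pT.
have sub_id (X : H1 -> H1) : (fun x => x - X x) = id \+ (-1 \*: X).
  by apply/funext => x /=; rewrite scaleN1r.
have MA n : M1 (fun x => x - A n x).
  rewrite sub_id; apply: commutant_sub => //; first exact: commutant_id.
  apply: poscone_commutant (pA n); rewrite sub_id; apply: commutant_sub => //.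
  exact: commutant_id.
have MB : M1 B.
  apply: commutant_strong_limit MA AB _ => //.
  apply: contractive_bounded => // x; rewrite -ler_sqr ?nnegrE ?nrm_ge0//.
  rewrite !nrm_sqr -sB -[B (B x)]/((B \o B) x) BB.
  by have /andP[] := pT x.
have [bij _ _ isoM isoV] := isoT.
exists (theta B); split.
- by case: bij => h _ _; apply: h.
- exact: adjoint_selfP (isoV _ _ MB MB (self_adjointP lB sB)).
- by rewrite -isoM// BB.
Qed.

Variable L : nat -> H1 -> H1.
Hypothesis ML : forall n, M1 (L n).
Hypothesis sL : forall n, self_adjoint (L n).
Hypothesis cL : forall n, contractive (L n).
Hypothesis LC : forall n m, L n \o L m = L m \o L n.
Hypothesis cL2 : forall n, contractive (theta (L n)).
Hypothesis theta1 : theta id = id.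

(** Products along a subsequence [f] of the [L n]; since the factors commute, such
a product is symmetric, and its square decreases with [m]. *)
Fixpoint prodL (f : nat -> nat) m : H1 -> H1 :=
  if m is m'.+1 then L (f m') \o prodL f m' else id.

Lemma prodL_commutant f m : M1 (prodL f m).
Proof.
by elim: m => [|m IH] /=; [apply: commutant_id|apply: commutant_comp].
Qed.

Lemma prodLC f m n x : prodL f m (L n x) = L n (prodL f m x).
Proof.
elim: m => //= m ->; exact: (congr1 (@^~ (prodL f m x)) (LC _ _)).
Qed.

Lemma prodL_self_adjoint f m : self_adjoint (prodL f m).
Proof. by elim: m => //= m IH x y; rewrite sL IH prodLC. Qed.

Lemma prodL_contractive f m : contractive (prodL f m).
Proof. by elim: m => [|m IH] x //=; apply: le_trans (cL _ _) (IH x). Qed.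

Lemma theta_prodLS f m : theta (prodL f m.+1) = theta (L (f m)) \o theta (prodL f m).
Proof. by rewrite -(star_isoM isoT)//; apply: prodL_commutant. Qed.

Lemma theta_prodLC f m n x :
  theta (prodL f m) (theta (L n) x) = theta (L n) (theta (prodL f m) x).
Proof.
have MP := prodL_commutant f m; have isoM := star_isoM isoT.
rewrite -[LHS]/((theta (prodL f m) \o theta (L n)) x) -isoM//.
have -> : prodL f m \o L n = L n \o prodL f m.
  by apply/funext => y; apply: prodLC.
by rewrite isoM.
Qed.

Lemma theta_prodL_contractive f m : contractive (theta (prodL f m)).
Proof.
elim: m => [|m IH] x; first by rewrite theta1.
by rewrite theta_prodLS; apply: le_trans (cL2 _ _) (IH x).
Qed.

Lemma rdot_prodL_sqr f m x :
  rdot (prodL f m (prodL f m x)) x = nrm (prodL f m x) ^+ 2.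
Proof. by rewrite prodL_self_adjoint nrm_sqr. Qed.

(** The strong limit of the squared products, characterized as the infimum of
their quadratic forms. *)
Lemma prodL_limit f : exists P, [/\ M1 P, self_adjoint P,
  forall x, 0 <= rdot (P x) x, 
  forall m x, rdot (P x) x <= nrm (prodL f m x) ^+ 2 &
  forall x b, (forall m, b <= nrm (prodL f m x) ^+ 2) -> b <= rdot (P x) x].
Proof.
pose A m (x : H1) := x - prodL f m (prodL f m x).
have AE m : A m = id \+ (-1 \*: (prodL f m \o prodL f m)).
  by apply/funext => x /=; rewrite scaleN1r.
have MA m : M1 (A m).
  have MP := prodL_commutant f m.
  by rewrite AE; apply: commutant_sub (commutant_comp _ _) => //; apply: commutant_id.
have lA m : linear (A m) by case: (MA m) => -[].
have sA m : self_adjoint (A m).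
  move=> x y; rewrite /A rdotDl rdotDr rdotNl rdotNr.
  by rewrite !prodL_self_adjoint.
have rA m x : rdot (A m x) x = rdot x x - nrm (prodL f m x) ^+ 2.
  by rewrite /A rdotDl rdotNl rdot_prodL_sqr.
have pA m x : 0 <= rdot (A m x) x <= rdot x x.
  rewrite rA subr_ge0 gerBl sqr_ge0 andbT -nrm_sqr ler_sqr ?nnegrE ?nrm_ge0//.
  exact: prodL_contractive.
have [m x|T [lT sT AT bT]] := increasing_strong_limit lA sA pA.
  by rewrite !rA lerD2l lerN2 ler_sqr ?nnegrE ?nrm_ge0//= cL.
have cA m := positive_contractive (lA m) (@sA m) (pA m).
have MT : M1 T.
  apply: (commutant_strong_limit S1b MA AT).
  exact: contractive_bounded lT (strong_limit_contractive cA AT).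
have rP x : rdot ((id \+ (-1 \*: T)) x) x = rdot x x - rdot (T x) x.
  by rewrite /= scaleN1r rdotDl rdotNl.
exists (id \+ (-1 \*: T)); split.
- by apply: commutant_sub MT => //; apply: commutant_id.
- by move=> x y; rewrite /= !scaleN1r rdotDl rdotDr rdotNl rdotNr sT.
- by move=> x; rewrite rP subr_ge0; have /andP[] := bT 0%N x.
- by move=> m x; rewrite rP; have /andP[+ _] := bT m x; rewrite rA; lra.
move=> x b hb; rewrite rP lerBrDr -lerBrDl.
apply: cvgr_to_le (cvg_rdotl x (AT x)) _; exists 0%N => // m _.
by rewrite rA lerD2l lerN2.
Qed.

(** As the factors commute, the last one can be applied first, where it is close
to multiplication by [r].  If the norms stayed above [b > 0], each step would
eventually lower them by at least [(1 - r) b / 2]. *)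
Lemma decay f x (r b : R) : 0 <= r < 1 ->
  (theta (L (f m)) x @[m --> \oo] --> r%:C *: x) ->
  (forall m, b <= nrm (theta (prodL f m) x)) -> b <= 0.
Proof.
move=> /andP[r0 r1] /cvg_nrmP Lx hb; rewrite leNgt; apply/negP => b0.
pose a m := nrm (theta (prodL f m) x).
pose d := (1 - r) * b / 2.
have d0 : 0 < d by rewrite /d divr_gt0// mulr_gt0// subr_gt0.
have [N hN] := Lx d d0.
have step m : (N <= m)%N -> a m.+1 <= a m - d.
  move=> Nm; rewrite /a theta_prodLS /= -theta_prodLC.
  have [[lP _] _] : M2 (theta (prodL f m)).
    have [[h _ _] _ _ _ _] := isoT; apply: h; exact: prodL_commutant.
  rewrite -(subrK (r%:C *: x) (theta (L (f m)) x)).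
  rewrite (linD _ _ lP) (linZ _ _ lP).
  apply: le_trans (nrmD _ _) _; rewrite nrmZr ger0_norm//.
  have h1 := theta_prodL_contractive f m (theta (L (f m)) x - r%:C *: x).
  have h2 := hN m Nm.
  have : (1 - r) * b <= (1 - r) * a m by rewrite ler_wpM2l ?hb// subr_ge0 ltW.
  rewrite -/(a m); move: h1 h2; rewrite /d; lra.
have iter_step k : a (N + k)%N <= a N - k%:R * d.
  elim: k => [|k IH]; first by rewrite addn0 mul0r subr0.
  rewrite addnS; apply: le_trans (step _ (leq_addr _ _)) _.
  by rewrite -natr1 mulrDl mul1r; lra.
pose k := Num.bound (a N / d).
have kd : a N / d < k%:R by apply: archi_boundP; rewrite divr_ge0 ?nrm_ge0 ?ltW.
move: kd; rewrite ltr_pdivrMr// => kd.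
have := iter_step k; have := nrm_ge0 (theta (prodL f (N + k)) x).
rewrite -/(a _); lra.
Qed.

(** An instance of the normality of *-isomorphisms.  The subsequence [f] is chosen
so that the products move [xi] by less than half its norm, which keeps the
infimum [P] of their squares away from [0]; if [r < 1] then [decay] forces [theta P = 0]. *)
Theorem star_iso_strong_limit (xi : H1) (r : R) : xi != 0 -> 0 <= r <= 1 ->
  strong_limit L id -> strong_limit (fun n => theta (L n)) (fun x => r%:C *: x) ->
  r = 1.
Proof.
move=> xi0 /andP[r0 r1] L1 L2; apply/eqP; rewrite eq_le r1 leNgt /=.
apply/negP => r_lt1; have r01 : 0 <= r < 1 by rewrite r0.
have nxi : 0 < nrm xi.
  rewrite lt_neqAle nrm_ge0 andbT eq_sym; apply: contraNneq xi0 => h.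
  by apply/eqP; apply: nrm0_eq0.
(* the errors sum to at most half of the norm of xi, see lb *)
have close m : exists k, (m <= k)%N /\
    nrm (L k xi - xi) < nrm xi * 2^-1 ^+ m.+2.
  have e0 : 0 < nrm xi * 2^-1 ^+ m.+2 by rewrite mulr_gt0// exprn_gt0// invr_gt0.
  have /cvg_nrmP/(_ _ e0)[N hN] := L1 xi.
  by exists (maxn m N); rewrite leq_maxl; split=> //; apply: hN; rewrite leq_maxr.
have [f hf] := choice close.
have lb m : nrm (prodL f m xi - xi) <= nrm xi * (2^-1 - 2^-1 ^+ m.+1).
  elim: m => [|m IH]; first by rewrite /= subrr nrm0 expr1 subrr mulr0.
  rewrite /= -prodLC -(subrK (prodL f m xi) (prodL f m _)) -addrA.
  apply: le_trans (nrmD _ _) _; have [[lP _] _] := prodL_commutant f m.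
  rewrite -linB//; have := prodL_contractive f m (L (f m) xi - xi).
  have [_] := hf m; move: IH; rewrite !exprS; lra.
have [P [MP sP P0 Pf Pb]] := prodL_limit f.
have P1 x : 0 <= rdot (P x) x <= rdot x x.
  by rewrite P0 /=; have := Pf 0%N x; rewrite /= nrm_sqr.
have [B [MB sB PB]] := star_iso_square MP sP P1.
have [[Mtheta inj _] _ isoZ isoM isoV] := isoT.
have Bb m x : nrm (B x) <= nrm (theta (prodL f m) x).
  have Mp := prodL_commutant f m.
  have MQ : M1 (prodL f m \o prodL f m) by exact: commutant_comp.
  have rQ y : rdot ((prodL f m \o prodL f m \+ (-1 \*: P)) y) y
      = nrm (prodL f m y) ^+ 2 - rdot (P y) y.
    by rewrite /= scaleN1r rdotDl rdotNl rdot_prodL_sqr.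
  (* the positive element prodL f m ^ 2 - P has a positive image *)
  have [||y|C [MC sC QC]] := @star_iso_square (prodL f m \o prodL f m \+ (-1 \*: P)).
  - exact: commutant_sub.
  - move=> y z; rewrite /= !scaleN1r !rdotDl !rdotDr !rdotNl !rdotNr.
    by rewrite sP !prodL_self_adjoint.
  - rewrite rQ subr_ge0 Pf /=.
    have : nrm (prodL f m y) ^+ 2 <= rdot y y.
      by rewrite -nrm_sqr ler_sqr ?nnegrE ?nrm_ge0//; apply: prodL_contractive.
    have := P0 y; lra.
  have sp2 : self_adjoint (theta (prodL f m)).
    have [[lp _] _] := Mp.
    apply: adjoint_selfP (isoV _ _ Mp Mp (self_adjointP lp _)).
    exact: prodL_self_adjoint.
  have := congr1 (fun F => rdot (F x) x) QC.
  rewrite (star_isoD isoT)//; last exact: commutant_scale.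
  rewrite isoZ// isoM// PB /= scaleN1r rdotDl rdotNl sB sp2 sC -!nrm_sqr => h.
  rewrite -ler_sqr ?nnegrE ?nrm_ge0// -subr_ge0 h; exact: sqr_ge0.
have B0 x : B x = 0.
  apply: nrm0_eq0; apply/eqP; rewrite eq_le nrm_ge0 andbT.
  apply: (@decay f x r) => //; apply/cvg_nrmP => e e0.
  have /cvg_nrmP/(_ _ e0)[N hN] := L2 x; exists N => m Nm.
  by apply: hN; apply: leq_trans Nm _; have [] := hf m.
have P00 : P = 0 \*: id.
  apply: inj; rewrite ?inE//.
    by apply: commutant_scale => //; apply: commutant_id.
  rewrite isoZ ?PB; last exact: commutant_id.
  by apply/funext => x /=; rewrite !B0 scale0r.
have : (nrm xi / 2) ^+ 2 <= rdot (P xi) xi.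
  apply: Pb => m; rewrite ler_sqr ?nnegrE ?nrm_ge0 ?divr_ge0 ?nrm_ge0//.
  have := nrmD (prodL f m xi) (xi - prodL f m xi).
  rewrite addrC subrK nrmBC => h; have := lb m.
  have : 0 < nrm xi * 2^-1 ^+ m.+1 by rewrite mulr_gt0// exprn_gt0// invr_gt0.
  move: h; rewrite mulrBr; lra.
rewrite P00 /= scale0r rdot0l; apply/negP; rewrite -ltNge.
by rewrite exprn_gt0// divr_gt0.
Qed.

End StarIsomorphisms.

(** * Supports and far copies in the wreath product *)

Section Supports.
Variable Gam : groupType.
Implicit Types (g h k : wreath Gam) (P Q : set nat) (s t : finperm).
Local Open Scope group_scope.

Definition supported P g := forall i, ~ P i -> g.1 i = 1 /\ g.2 i = i.

Lemma supported_fixV P g i : supported P g -> ~ P i -> finperm_inv g.2 i = i.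
Proof. by move=> gP /gP[_ e]; rewrite -[in LHS]e finperm_funK. Qed.

Lemma supported_memV P g i : supported P g -> P i -> P (finperm_inv g.2 i).
Proof.
move=> gP Pi; apply: contrapT => nP; have [_ e] := gP _ nP.
by apply: nP; rewrite finperm_invK in e; rewrite -e.
Qed.

Lemma supported_mem P g i : supported P g -> P i -> P (g.2 i).
Proof.
move=> gP Pi; apply: contrapT => nP; have := supported_fixV gP nP.
by rewrite finperm_funK => e; apply: nP; rewrite -e.
Qed.

Lemma supported_commute P Q g h : supported P g -> supported Q h ->
  (forall i, P i -> ~ Q i) -> commute g h.
Proof.
move=> gP hQ PQ; congr pair.
  apply: finsupp_ext => i /=; have [Pi|nPi] := pselect (P i).
    have nQi := PQ i Pi; have nQi' := PQ _ (supported_memV gP Pi).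
    by rewrite (hQ _ nQi).1 (hQ _ nQi').1 (supported_fixV hQ nQi) mulg1 mul1g.
  rewrite (gP _ nPi).1 (supported_fixV gP nPi) mul1g.
  have [Qi|nQi] := pselect (Q i); last first.
    by rewrite (supported_fixV hQ nQi) (gP _ nPi).1 mulg1.
  have nPi' : ~ P (finperm_inv h.2 i) by move=> /PQ; apply; apply: supported_memV.
  by rewrite (gP _ nPi').1 mulg1.
apply: finperm_ext => i /=; have [Pi|nPi] := pselect (P i).
  by rewrite (hQ _ (PQ i Pi)).2 (hQ _ (PQ _ (supported_mem gP Pi))).2.
rewrite (gP _ nPi).2; have [Qi|nQi] := pselect (Q i).
  have nPi' : ~ P (h.2 i) by move=> /PQ; apply; apply: supported_mem.
  by rewrite (gP _ nPi').2.
by rewrite (hQ _ nQi).2 (gP _ nPi).2.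
Qed.

Lemma finite_nat_bounded P : finite_set P -> exists d, forall i, P i -> (i < d)%N.
Proof.
move=> /finite_seqP[s ->]; exists (\max_(i <- s) i).+1 => i /= si.
by rewrite ltnS; apply: (@leq_bigmax_seq _ s xpredT id).
Qed.

Lemma bounded_support g : exists2 d, (0 < d)%N & supported [set i | (i < d)%N] g.
Proof.
have [d1 h1] := finite_nat_bounded (finsupp_finite g.1).
have [d2 h2] := finite_nat_bounded (finperm_finite g.2).
exists (maxn d1 d2).+1 => // i /= /negP; rewrite -leqNgt gtn_max => /andP[i1 i2].
split; apply/eqP/negPn/negP.
  by move=> /h1; rewrite ltnNge ltnW.
by move=> /h2; rewrite ltnNge ltnW.
Qed.

Lemma supported_sub P Q g : supported P g -> (forall i, P i -> Q i) -> supported Q g.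
Proof. by move=> gP PQ i nQ; apply: gP => /PQ. Qed.

Lemma supportedV P g : supported P g -> supported P g^-1.
Proof.
move=> gP i nP; have [e1 e2] := gP _ nP.
by split; [rewrite /= e2 e1 invg1|exact: supported_fixV gP nP].
Qed.

Definition relabel t g : wreath Gam := g ^ (wreath_perm Gam t)^-1.

Lemma wreath_permM s t :
  wreath_perm Gam (s * t) = wreath_perm Gam s * wreath_perm Gam t.
Proof.
congr pair; apply: finsupp_ext => i /=.
by rewrite mulg1.
Qed.

Lemma wreath_permV t : wreath_perm Gam t^-1 = (wreath_perm Gam t)^-1.
Proof. by congr pair; apply: finsupp_ext => i /=; rewrite invg1. Qed.

Lemma relabelE t g : relabel t g = wreath_perm Gam t * g * (wreath_perm Gam t)^-1.
Proof. by rewrite /relabel conjgE invgK mulgA. Qed.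

Lemma relabelM t g h : relabel t (g * h) = relabel t g * relabel t h.
Proof. exact: conjMg. Qed.

Lemma relabelV t g : relabel t g^-1 = (relabel t g)^-1.
Proof. exact: conjVg. Qed.

Lemma relabel_relabel s t g : relabel s (relabel t g) = relabel (s * t) g.
Proof. by rewrite /relabel wreath_permM invgM conjgM. Qed.

Lemma relabel_supported P t g : supported P g ->
  supported [set i | P (finperm_inv t i)] (relabel t g).
Proof.
move=> gP i nP; rewrite relabelE /=; have [e1 e2] := gP _ nP; split.
  by rewrite mul1g invg1 mulg1.
by rewrite e2 finperm_invK.
Qed.

Lemma relabel_id P t g : supported P g -> (forall i, P i -> t i = i) -> relabel t g = g.
Proof.
move=> gP tP; apply/conjg_fixP/commgP/commuteV.
apply: (supported_commute (Q := [set i | t i <> i]) gP) => [i /= /contrapT ti//|i Pi].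
by apply; apply: tP.
Qed.

End Supports.

Section BlockPermutations.
Variables (d : nat) (d0 : (0 < d)%N).
Implicit Types (s t : finperm) (i n m D : nat).
Local Open Scope group_scope.

Let block_perm_funK (f f' : nat -> nat) : cancel f f' ->
  cancel (fun i => f (i %/ d) * d + i %% d)%N (fun i => f' (i %/ d) * d + i %% d)%N.
Proof.
move=> fK i; rewrite divnMDl// modnMDl modn_mod (divn_small (ltn_pmod _ _))//.
by rewrite addn0 fK -divn_eq.
Qed.

Let block_perm_finite t : finite_set [set i | (t (i %/ d) * d + i %% d)%N != i].
Proof.
have [D hD] := finite_nat_bounded (finperm_finite t).
apply: sub_finite_set (finite_II (D * d)) => i /= h.
rewrite -ltn_divLR//; apply: hD => /=; apply: contraNneq h => ->.
by rewrite -divn_eq.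
Qed.

Definition block_perm t : finperm :=
  @FinPerm (fun i => t (i %/ d) * d + i %% d)%N
    (fun i => finperm_inv t (i %/ d) * d + i %% d)%N
    (block_perm_funK (@finperm_funK t)) (block_perm_funK (@finperm_invK t))
    (block_perm_finite t).

Lemma block_permM s t : block_perm (s * t) = block_perm s * block_perm t.
Proof.
apply: finperm_ext => i /=; rewrite divnMDl// modnMDl modn_mod.
by rewrite (divn_small (ltn_pmod _ _))// addn0.
Qed.

Lemma block_perm_fix t i : t (i %/ d)%N = (i %/ d)%N -> block_perm t i = i.
Proof. by move=> /= ->; rewrite -divn_eq. Qed.

Lemma divn_block_permV t i :
  (finperm_inv (block_perm t) i %/ d)%N = finperm_inv t (i %/ d)%N.
Proof. by rewrite /= divnMDl// (divn_small (ltn_pmod _ _))// addn0. Qed.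

Definition swap_fun n m i := if i == n then m else if i == m then n else i.

Lemma swap_funK n m : involutive (swap_fun n m).
Proof.
move=> i; rewrite /swap_fun; have [->|h1] := eqVneq i n.
  by rewrite eqxx; case: eqP.
have [->|h2] := eqVneq i m; first by rewrite eqxx.
by rewrite (negbTE h1) (negbTE h2).
Qed.

Lemma swap_finite n m : finite_set [set i | swap_fun n m i != i].
Proof.
apply: sub_finite_set (finite_II (maxn n m).+1) => i /=.
rewrite /swap_fun ltnS leq_max; have [->|h1] := eqVneq i n.
  by rewrite leqnn.
by have [->|h2] := eqVneq i m; rewrite ?leqnn ?orbT ?eqxx.
Qed.

Definition swap n m : finperm :=
  FinPerm (swap_funK n m) (swap_funK n m) (swap_finite n m).

Lemma swapL n m : swap n m n = m.
Proof. by rewrite /= /swap_fun eqxx. Qed.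

Lemma swap_fix n m i : i <> n -> i <> m -> swap n m i = i.
Proof. by move=> /eqP /negbTE h /eqP /negbTE h'; rewrite /= /swap_fun h h'. Qed.

Variable Gam : groupType.
Implicit Types g h a : wreath Gam.

Definition copy g n := relabel (block_perm (swap 0 n)) g.

Lemma copyV g n : copy g^-1 n = (copy g n)^-1.
Proof. exact: relabelV. Qed.

Definition in_block0 g := supported [set i | (i < d)%N] g.

Lemma copy_supported g n : in_block0 g -> supported [set i | (i %/ d)%N = n] (copy g n).
Proof.
move=> g0; apply: (supported_sub (relabel_supported g0)) => i id.
have : (finperm_inv (block_perm (swap 0 n)) i %/ d)%N = 0%N by rewrite divn_small.
rewrite divn_block_permV /= /swap_fun; have [-> ->//|/eqP i0] := eqVneq (i %/ d)%N 0%N.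
by have [->|_ /i0] := eqVneq (i %/ d)%N n.
Qed.

Lemma copy_commute g h n m : in_block0 g -> in_block0 h -> n <> m ->
  commute (copy g n) (copy h m).
Proof.
move=> g0 h0 nm.
by apply: (supported_commute (copy_supported g0) (copy_supported h0)) => i /= ->.
Qed.

Lemma copy_commute_far g a n D : in_block0 g -> supported [set i | (i < D)%N] a ->
  (D <= n)%N -> commute (copy g n) a.
Proof.
move=> g0 aD Dn; apply: (supported_commute (copy_supported g0) aD) => i /= id.
by apply/negP; rewrite -leqNgt (leq_trans Dn)// -id leq_div.
Qed.

(** A copy depends only on the block that it occupies: two permutations of the
blocks with the same value at [0] differ by one fixing block [0], which commutes
with [g]. *)
Lemma relabel_copy g t n : in_block0 g ->
  relabel (block_perm t) (copy g n) = copy g (t n).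
Proof.
move=> g0; pose r := (swap 0 (t n))^-1 * t * swap 0 n.
have -> : copy g (t n) = relabel (block_perm (swap 0 (t n))) (relabel (block_perm r) g).
  congr relabel; apply/esym/(relabel_id g0) => i id; apply: block_perm_fix.
  by rewrite (divn_small id) /r /= /swap_fun /= eqxx; case: eqP.
by rewrite /copy !relabel_relabel -!block_permM /r !mulgA mulgV mul1g.
Qed.

(** Any two distinct far blocks can be carried to any other two by two
transpositions of far blocks, and these commute with [a]. *)
Lemma exchangeable (T : Type) (F : wreath Gam -> T) g a D n m n' m' :
  (forall t x, F (relabel t x) = F x) -> in_block0 g ->
  supported [set i | (i < D)%N] a ->
  (D <= n)%N -> (D <= m)%N -> (D <= n')%N -> (D <= m')%N -> n <> m -> n' <> m' ->
  F (a^-1 * ((copy g m)^-1 * copy g n) * a) =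
  F (a^-1 * ((copy g m')^-1 * copy g n') * a).
Proof.
move=> FC g0 aD.
have swapF p q k l : (D <= p)%N -> (D <= q)%N ->
    F (a^-1 * ((copy g l)^-1 * copy g k) * a) =
    F (a^-1 * ((copy g (swap p q l))^-1 * copy g (swap p q k)) * a).
  move=> Dp Dq; rewrite -(FC (block_perm (swap p q))).
  rewrite 3!relabelM 2!relabelV !relabel_copy//.
  rewrite (relabel_id aD)// => i iD; apply: block_perm_fix; apply: swap_fix => e.
    by move: iD; rewrite /= ltnNge (leq_trans Dp)// -e leq_div.
  by move: iD; rewrite /= ltnNge (leq_trans Dq)// -e leq_div.
move=> Dn Dm Dn' Dm' nm nm'; rewrite (swapF n n' n m)// swapL.
set m1 := swap n n' m.
have m1n' : n' <> m1.
  by rewrite -(swapL n n') => /(can_inj (finperm_funK (swap n n'))).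
have Dm1 : (D <= m1)%N.
  by rewrite /m1 /= /swap_fun; case: (_ == _) => //; case: (_ == _).
by rewrite (swapF m1 m')// swapL swap_fix.
Qed.

End BlockPermutations.

(** * Averages of unitary operators *)

Section Averages.
Variables (R : realType) (G : groupType) (H : hilbert R) (pi : unitary_rep G H).
Implicit Types (u v : nat -> G) (x y : H) (k l n : nat) (g h : G).

(** The blocks [2^k <= n < 2^(k+1)] are disjoint for distinct [k] and move to
infinity, so that exchangeability applies to inner products of two different
means without boundary terms. *)
Definition dyadic_mean (w : nat -> H) k : H :=
  (2^-1 ^+ k)%:C *: \sum_(i < 2 ^ k) w (2 ^ k + i)%N.

Definition average u k : H -> H := fun x => dyadic_mean (fun n => pi (u n) x) k.

Lemma half_pow_ge0 k : 0 <= 2^-1 ^+ k :> R.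
Proof. by rewrite exprn_ge0// invr_ge0. Qed.

Lemma half_powK k (a : R) : 2^-1 ^+ k * (a *+ 2 ^ k) = a.
Proof.
by rewrite -[a *+ _]mulr_natr mulrCA natrX -exprMn mulVf ?pnatr_eq0// expr1n mulr1.
Qed.

Lemma rdot_dyadic_mean (w : nat -> H) k y (r : R) :
  (forall n, (2 ^ k <= n)%N -> rdot (w n) y = r) -> rdot (dyadic_mean w k) y = r.
Proof.
move=> wr; rewrite rdotZl rdot_suml.
under eq_bigr => i _ do rewrite wr ?leq_addr//.
by rewrite sumr_const card_ord half_powK.
Qed.

Lemma nrm_sum (I : Type) (s : seq I) (F : I -> H) :
  nrm (\sum_(i <- s) F i) <= \sum_(i <- s) nrm (F i).
Proof.
elim: s => [|i s IH]; first by rewrite !big_nil nrm0.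
by rewrite !big_cons (le_trans (nrmD _ _))// lerD2l.
Qed.

Lemma rep_nrm g x : nrm (pi g x) = nrm x.
Proof.
by apply/eqP; rewrite -(eqrXn2 (_ : 0 < 2)%N) ?nrm_ge0// !nrm_sqr /rdot rep_dot.
Qed.

Lemma rep_rdotV g x y : rdot (pi g x) y = rdot x (pi g^-1%g y).
Proof.
rewrite /rdot -(rep_dot pi g^-1%g) -[pi _ (pi g x)]/((pi g^-1%g \o pi g) x) -repM.
by rewrite mulVg rep1.
Qed.

Lemma average_linear u k : linear (average u k).
Proof.
move=> c x y; rewrite /average /dyadic_mean.
under eq_bigr => i _ do rewrite rep_linear.
by rewrite big_split /= -scaler_sumr scalerDr !scalerA mulrC.
Qed.

Lemma average_contractive u k : contractive (average u k).
Proof.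
move=> x; rewrite /average /dyadic_mean nrmZr ger0_norm ?half_pow_ge0//.
apply: (@le_trans _ _ (2^-1 ^+ k * (nrm x *+ 2 ^ k))); last by rewrite half_powK.
rewrite ler_wpM2l ?half_pow_ge0//; apply: le_trans (nrm_sum _ _) _.
under eq_bigr => i _ do rewrite rep_nrm.
by rewrite sumr_const card_ord.
Qed.

Lemma average_adjoint u k x y :
  rdot (average u k x) y = rdot x (average (fun n => (u n)^-1%g) k y).
Proof.
rewrite /average /dyadic_mean rdotZl rdotZr rdot_suml rdot_sumr.
by congr (_ * _); apply: eq_bigr => i _; rewrite rep_rdotV.
Qed.

Lemma commutant_sum (S : set (H -> H)) (F : nat -> H -> H) n :
  (forall A, S A -> bounded_operator A) -> (forall i, commutant S (F i)) ->
  commutant S (fun x => \sum_(i < n) F i x).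
Proof.
move=> Sb SF; elim: n => [|n IH].
  have -> : (fun x => \sum_(i < 0) F i x) = 0 \*: id.
    by apply/funext => x; rewrite big_ord0 /= scale0r.
  by apply: commutant_scale => //; apply: commutant_id.
have -> : (fun x => \sum_(i < n.+1) F i x) = (fun x => \sum_(i < n) F i x) \+ F n.
  by apply/funext => x; rewrite big_ord_recr.
exact: commutant_add.
Qed.

Lemma average_commutant (S : set (H -> H)) u k :
  (forall A, S A -> bounded_operator A) -> (forall n, commutant S (pi (u n))) ->
  commutant S (average u k).
Proof.
move=> Sb Su; apply: commutant_scale => //.
exact: (@commutant_sum S (fun i => pi (u (2 ^ k + i)%N))).
Qed.

Lemma rep_bounded g : bounded_operator (pi g).
Proof.
by apply: contractive_bounded; [apply: rep_linear|move=> x; rewrite rep_nrm].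
Qed.

Lemma rep_commutant_bounded A : commutant (range pi) A -> bounded_operator A.
Proof. by case. Qed.

Lemma rep_in_vN g : rep_vN pi (pi g).
Proof.
split; first exact: rep_bounded.
by move=> A [_ h]; rewrite h//; exists g.
Qed.

Lemma average_in_vN u k : rep_vN pi (average u k).
Proof. by apply: average_commutant => [A []//|n]; apply: rep_in_vN. Qed.

Lemma average_commute u k h x : (forall n, (2 ^ k <= n)%N -> commute (u n) h) ->
  average u k (pi h x) = pi h (average u k x).
Proof.
move=> uh; have lh := @rep_linear _ _ _ pi h.
rewrite /average /dyadic_mean (linZ _ _ lh); congr (_ *: _).
have -> : pi h (\sum_(i < 2 ^ k) pi (u (2 ^ k + i)%N) x) =
    \sum_(i < 2 ^ k) pi h (pi (u (2 ^ k + i)%N) x).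
  by apply: (big_morph (pi h)) => [a b|]; [rewrite (linD _ _ lh)|rewrite (lin0 lh)].
apply: eq_bigr => i _; rewrite -[LHS]/((pi _ \o pi h) x) -[RHS]/((pi h \o pi _) x).
by rewrite -!repM uh ?leq_addr.
Qed.

Lemma average_averageC u v k l : (forall n m, commute (u n) (v m)) ->
  average u k \o average v l = average v l \o average u k.
Proof.
move=> uv; have [_ h] : commutant [set average v l] (average u k).
  apply: average_commutant => [_ ->|n].
    exact: contractive_bounded (average_linear _ _) (@average_contractive _ _).
  split; first exact: rep_bounded.
  move=> _ ->; apply/funext => x /=; rewrite average_commute// => m _.
  exact/commute_sym/uv.
exact: h.
Qed.

End Averages.

Section ExchangeableMeans.
Variables (R : realType) (H : hilbert R).

(** Two different means have inner product [be], and the squared norm of the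
[k]-th one is [be + 2^-k (al - be)]; hence the squared distance between the
[k]-th and the [l]-th one is [(2^-k + 2^-l) (al - be)]. *)
Lemma exchangeable_mean_cvg (w : nat -> H) (D : nat) (al be : R) :
  (forall n, rdot (w n) (w n) = al) ->
  (forall n m, (D <= n)%N -> (D <= m)%N -> n <> m -> rdot (w n) (w m) = be) ->
  exists l : H, dyadic_mean w k @[k --> \oo] --> l.
Proof.
move=> wal wbe; pose A := dyadic_mean w.
have D2 k i : (D <= k)%N -> (D <= 2 ^ k + i)%N.
  move=> Dk; rewrite (leq_trans Dk)//.
  by rewrite (leq_trans (ltnW (ltn_expl k (isT : 1 < 2)%N)))// leq_addr.
have cross k l : (D <= k)%N -> (k < l)%N -> rdot (A k) (A l) = be.
  move=> Dk kl; have Dl : (D <= l)%N by rewrite (leq_trans Dk)// ltnW.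
  rewrite rdotZl rdot_suml.
  under eq_bigr => i _.
    rewrite rdotC (@rdot_dyadic_mean _ _ _ _ _ be); last first.
      move=> n ln; apply: wbe; last 1 first.
      - move=> e; have := ltn_ord i.
        rewrite -(ltn_add2l (2 ^ k)) -e addnn -mul2n -expnS.
        by apply/negP; rewrite -leqNgt (leq_trans _ ln)// leq_pexp2l.
      - by rewrite (leq_trans _ ln)// -[(2 ^ l)%N]addn0 D2.
      - exact: D2.
    over.
  by rewrite sumr_const card_ord half_powK.
have gram k (i j : 'I_(2 ^ k)) : (D <= k)%N ->
    rdot (w (2 ^ k + i)%N) (w (2 ^ k + j)%N) = be + (if j == i then al - be else 0).
  move=> Dk; have [->|ji] := eqVneq j i; first by rewrite wal addrC subrK.
  rewrite addr0 wbe ?D2// => /addnI/val_inj e.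
  by rewrite e eqxx in ji.
have diag k : (D <= k)%N -> rdot (A k) (A k) = be + 2^-1 ^+ k * (al - be).
  move=> Dk; rewrite rdotZl rdot_suml.
  under eq_bigr => i _.
    rewrite rdotZr rdot_sumr.
    under eq_bigr => j _ do rewrite gram//.
    rewrite big_split /= sumr_const card_ord -big_mkcond big_pred1_eq mulrDr half_powK.
    over.
  by rewrite sumr_const card_ord half_powK.
have be_al : 0 <= al - be.
  have <- : rdot (w D) (w D.+1) = be by apply: wbe => // /n_Sn.
  rewrite subr_ge0; apply: (le_trans (rdot_le _ _)).
  rewrite -[al](wal D) -nrm_sqr expr2.
  suff -> : nrm (w D.+1) = nrm (w D) by [].
  by apply/eqP; rewrite -(eqrXn2 (_ : 0 < 2)%N) ?nrm_ge0// !nrm_sqr !wal.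
apply: cauchy_nrm => e e0.
have e20 : 0 < e ^+ 2 / 2 by rewrite divr_gt0// exprn_gt0.
pose N := maxn D (Num.bound ((al - be) / (e ^+ 2 / 2))).
have smallN : 2^-1 ^+ N * (al - be) < e ^+ 2 / 2.
  rewrite exprVn mulrC ltr_pdivrMr ?exprn_gt0// -ltr_pdivrMl// mulrC.
  apply: lt_le_trans (archi_boundP _) _; first by rewrite divr_ge0// ltW.
  rewrite -natrX ler_nat; apply: leq_trans (ltnW (ltn_expl _ (isT : 1 < 2)%N)).
  by rewrite leq_maxr.
have small n : (N <= n)%N -> 2^-1 ^+ n * (al - be) < e ^+ 2 / 2.
  move=> Nn; apply: le_lt_trans smallN; rewrite ler_wpM2r//.
  by rewrite ler_wiXn2l ?invr_ge0// invf_le1// ler1n.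
have DN n : (N <= n)%N -> (D <= n)%N by apply: leq_trans; rewrite leq_maxl.
have dist k l : (N <= k)%N -> (k < l)%N -> nrm (A k - A l) < e.
  move=> Nk kl; have Nl : (N <= l)%N by rewrite (leq_trans Nk)// ltnW.
  rewrite -ltr_sqr ?nnegrE ?nrm_ge0 ?(ltW e0)// nrmB_sqr !nrm_sqr.
  rewrite (cross k l (DN k Nk) kl) (diag k (DN k Nk)) (diag l (DN l Nl)).
  have := small k Nk; have := small l Nl; lra.
exists N => n m Nn Nm; have [nm|mn|->] := ltngtP n m.
- exact: dist.
- by rewrite nrmBC; apply: dist.
- by rewrite subrr nrm0.
Qed.

End ExchangeableMeans.

(** * Central states on factor representations *)

Section CentralStates.
Variables (R : realType) (Gam : groupType) (phi : wreath Gam -> R[i]).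
Hypothesis phi1 : phi 1%g = 1.
Hypothesis central : perm_central phi.
Variable D : gns phi.
Hypothesis factor : factor_representation (gns_rep D).
Local Notation H := (gns_space D).
Local Notation pi := (gns_rep D).
Local Notation xi := (gns_vector D).

Lemma central_relabel t g : phi (relabel t g) = phi g.
Proof. by rewrite relabelE -wreath_permV central wreath_permV mulgA mulVg mul1g. Qed.

Lemma gns_vector_nrm : nrm xi = 1.
Proof.
apply/eqP; rewrite -(eqrXn2 (_ : 0 < 2)%N) ?nrm_ge0// nrm_sqr expr1n.
by rewrite /rdot -{1}[xi]/(id xi) -(rep1 pi) -gns_state phi1.
Qed.

Lemma stateV g : phi g^-1%g = (phi g)^*.
Proof.
rewrite !(gns_state D) -hdotC -(rep_dot pi g).
by rewrite -[pi _ (pi _ xi)]/((pi g \o pi g^-1%g) xi) -repM mulgV rep1.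
Qed.

Variables (d : nat) (d0 : (0 < d)%N) (g : wreath Gam).
Hypothesis g0 : supported [set i | (i < d)%N] g.
Local Notation T := (average pi (copy d0 g)).

(** Convergence on the orbit of the cyclic vector comes from exchangeability; it
extends to the span by linearity, and to the closure because the averages are
contractions. *)
Lemma average_copy_cvg x : exists l : H, T k x @[k --> \oo] --> l.
Proof.
have orbit_cvg a : exists l : H, T k (pi a xi) @[k --> \oo] --> l.
  have [D' _ aD] := bounded_support a.
  pose F x := complex.Re (phi x).
  have FE n m : rdot (pi (copy d0 g n) (pi a xi)) (pi (copy d0 g m) (pi a xi)) =
      F (a^-1 * ((copy d0 g m)^-1 * copy d0 g n) * a)%g.
    rewrite /F (gns_state D); move: (copy d0 g n) (copy d0 g m) => p q.
    by rewrite !repM /= -/(rdot _ xi) !rep_rdotV !invgK.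
  apply: (@exchangeable_mean_cvg _ _ _ D' 1
    (F (a^-1 * ((copy d0 g D'.+1)^-1 * copy d0 g D') * a)%g)).
    by move=> n; rewrite -nrm_sqr !rep_nrm gns_vector_nrm expr1n.
  move=> n m Dn Dm nm; rewrite FE; apply: (@exchangeable _ _ _ _ F _ _ D') => //.
    by move=> t y; rewrite /F central_relabel.
have lT k : linear (T k) := average_linear _ _ _.
have cT k : contractive (T k) := @average_contractive _ _ _ _ _ _.
have span_cvg n (c : 'I_n -> R[i]) (a : 'I_n -> wreath Gam) :
    exists l : H, T k (\sum_(i < n) c i *: pi (a i) xi) @[k --> \oo] --> l.
  elim: n c a => [|n IH] c a.
    by exists 0; under eq_fun => k do rewrite big_ord0 lin0//; apply: cvg_cst.
  have [l1 h1] := IH (fun i => c (widen_ord (leqnSn n) i))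
                     (fun i => a (widen_ord (leqnSn n) i)).
  have [l2 h2] := orbit_cvg (a ord_max).
  exists (l1 + c ord_max *: l2).
  under eq_fun => k do rewrite big_ord_recr /= linD// linZ//.
  by apply: cvgD => //; apply: cvgZr.
apply: cauchy_nrm => e e0.
have e30 : 0 < e / 3 by rewrite divr_gt0.
have [v [n [c [a vE]]] xv] := dense_nrm x (@gns_cyclic _ _ _ D) e30.
have [l] := span_cvg n c a; rewrite -vE => /cvg_nrmP h.
have e60 : 0 < e / 6 by rewrite divr_gt0.
have [N hN] := h _ e60; exists N => k m Nk Nm.
have -> : T k x - T m x = (T k (x - v) - T m (x - v)) + ((T k v - l) - (T m v - l)).
  rewrite (linB _ _ (lT k)) (linB _ _ (lT m)).
  move: (T k x) (T k v) (T m x) (T m v) => p q r s.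
  by rewrite [RHS]addrACA -opprD !addrA !subrK opprB addrA subrK.
have := nrmD (T k (x - v) - T m (x - v)) ((T k v - l) - (T m v - l)).
have := nrmD (T k (x - v)) (- T m (x - v)); have := nrmD (T k v - l) (- (T m v - l)).
rewrite !nrmN; have := cT k (x - v); have := cT m (x - v).
have := hN k Nk; have := hN m Nm; rewrite nrmBC in xv; lra.
Qed.

(** The limit commutes with each [pi h], as [h] commutes with all far copies, and
lies in the von Neumann algebra: in a factor it is a scalar.  Its diagonal
coefficient at the cyclic vector is [phi g], because every copy of [g] has the
same value under a central state. *)
Lemma average_copy_strong_limit : strong_limit T (fun x => phi g *: x).
Proof.
have [E TE] := choice average_copy_cvg.
have lT k : linear (T k) := average_linear _ _ _.
have cT k : contractive (T k) := @average_contractive _ _ _ _ _ _.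
have lE : linear E := strong_limit_linear lT TE.
have bE : bounded_operator E.
  by apply: contractive_bounded => //; apply: strong_limit_contractive TE.
have ME : rep_vN pi E.
  by apply: commutant_strong_limit TE bE => [A []//|k]; apply: average_in_vN.
have E_comm : commutant (range pi) E.
  split=> // _ [h _ <-]; apply/funext => x /=.
  have [D' _ hD] := bounded_support h.
  have lim1 : pi h (T k x) @[k --> \oo] --> pi h (E x).
    by have [_ cpi] := rep_bounded pi h; apply: continuous_cvg; [exact: cpi|exact: TE].
  apply: norm_cvg_unique (TE (pi h x)) _; apply: cvg_trans lim1.
  apply: near_eq_cvg; exists D' => // k /= Dk; apply/esym.
  apply: average_commute => n kn; apply: (copy_commute_far _ g0 hD).
  by rewrite (leq_trans Dk)// (leq_trans (ltnW (ltn_expl k (isT : 1 < 2)%N))).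
have ME' : commutant (rep_vN pi) E.
  by split=> // A [_ h]; rewrite h.
have [c _ cE] : range (fun (c : R[i]) (x : H) => c *: x) E by rewrite -factor.
have phiE : phi g = hdot H (E xi) xi.
  have const y r : (forall n, rdot (pi (copy d0 g n) xi) y = r) -> rdot (E xi) y = r.
    move=> hr; apply: (cvg_unique (@norm_hausdorff R R^o) (cvg_rdotl y (TE xi))).
    have -> : (fun k => rdot (T k xi) y) = (fun=> r).
      by apply/funext => k; apply: rdot_dyadic_mean.
    exact: cvg_cst.
  have copyE n : hdot H (pi (copy d0 g n) xi) xi = phi g.
    by rewrite -gns_state central_relabel.
  rewrite hdotE (const _ (complex.Re (phi g))); last by move=> n; rewrite /rdot copyE.
  rewrite (const _ (complex.Im (phi g))); first by case: (phi g).
  by move=> n; have := copyE n; rewrite hdotE => /(congr1 (@complex.Im R)).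
have : phi g = c.
  rewrite phiE -cE linearZl_LR /= -{1}[xi]/(id xi) -(rep1 pi) -gns_state phi1.
  exact: mulr1.
by move=> ->; rewrite cE.
Qed.

End CentralStates.

(** * From scalar limits to contractions tending to the identity *)

Section Defect.
Variables (R : realType) (H : hilbert R).
Implicit Types (T U : H -> H) (c : R[i]) (S : set (H -> H)).

(** With [T'] adjoint to [T], [defect c T T'] is [1 - Z^* Z] for the contraction
[Z = (T - c) / 2].  It turns [T_n --> b] into a limit that is [1] exactly when
[b = c], through symmetric contractions. *)
Definition gap c T : H -> H := (2^-1)%:C \*: (T \+ (- c) \*: id).
Definition defect c T T' : H -> H := id \+ -1 \*: (gap c^* T' \o gap c T).

Lemma gap_commutant S c T : (forall A, S A -> bounded_operator A) ->
  commutant S T -> commutant S (gap c T).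
Proof.
move=> Sb ST; apply: commutant_scale => //; apply: commutant_add => //.
by apply: commutant_scale => //; apply: commutant_id.
Qed.

Lemma defect_commutant S c T T' : (forall A, S A -> bounded_operator A) ->
  commutant S T -> commutant S T' -> commutant S (defect c T T').
Proof.
move=> Sb ST ST'; apply: commutant_sub => //; first exact: commutant_id.
by apply: commutant_comp => //; apply: gap_commutant.
Qed.

(** The defect lies in every commutant containing its two arguments, so commutation
passes from the generators to one defect and then to the other. *)
Lemma defectC c T T' U U' : bounded_operator T -> bounded_operator T' ->
  bounded_operator U -> bounded_operator U' ->
  T \o U = U \o T -> T \o U' = U' \o T -> T' \o U = U \o T' -> T' \o U' = U' \o T' ->
  defect c T T' \o defect c U U' = defect c U U' \o defect c T T'.
Proof.
move=> bT bT' bU bU' TU TU' T'U T'U'.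
have TSb : forall A, [set T; T'] A -> bounded_operator A by move=> _ [->|->].
have [bD hD] : commutant [set T; T'] (defect c U U').
  by apply: defect_commutant => //; split=> // _ [->|->].
have [_ h] : commutant [set defect c U U'] (defect c T T').
  apply: defect_commutant => [_ ->//||]; split=> // _ ->; apply/esym.
  - by apply: hD; left.
  - by apply: hD; right.
exact: h.
Qed.

Lemma rdotZC c (x y : H) : rdot (c *: x) y = rdot x (c^* *: y).
Proof.
rewrite /rdot linearZl_LR linearZr_LR /=; congr (complex.Re (_ * _)).
exact/esym/conjcK.
Qed.

Lemma gap_adjoint c T T' : (forall x y, rdot (T x) y = rdot x (T' y)) ->
  forall x y, rdot (gap c T x) y = rdot x (gap c^* T' y).
Proof.
move=> TT' x y; rewrite /gap /= rdotZl rdotZr rdotDl rdotDr TT' rdotZC.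
by rewrite rmorphN.
Qed.

Lemma gap_linear c T : linear T -> linear (gap c T).
Proof.
move=> lT a x y; rewrite /gap /= lT [- c *: (_ + _)]scalerDr addrACA scalerDr.
congr (_ + _); rewrite [- c *: _]scalerA [- c * a]mulrC -scalerA -scalerDr.
by rewrite !scalerA [a * _]mulrC.
Qed.

Lemma gap_contractive c T : normc c <= 1 -> contractive T -> contractive (gap c T).
Proof.
move=> c1 cT x; rewrite /gap /= nrmZr ger0_norm ?invr_ge0//.
have := nrmD (T x) (- c *: x); rewrite scaleNr nrmN nrmZ.
have : normc c * nrm x <= 1 * nrm x by rewrite ler_wpM2r ?nrm_ge0.
have := cT x; rewrite mul1r; lra.
Qed.

Lemma normc_conj c : normc c^* = normc c.
Proof. by case: c => a b /=; rewrite sqrrN. Qed.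

Section Pair.
Variables (c : R[i]) (T T' : H -> H).
Hypothesis c1 : normc c <= 1.
Hypothesis TT' : forall x y, rdot (T x) y = rdot x (T' y).
Hypotheses (cT : contractive T) (cT' : contractive T').

Lemma defect_self_adjoint : self_adjoint (defect c T T').
Proof.
have adj := gap_adjoint c TT'; move=> x y.
rewrite /defect /= !scaleN1r rdotDl rdotDr rdotNl rdotNr -adj.
by rewrite [rdot (gap _ _ _) y]rdotC -adj (rdotC (gap c T y)).
Qed.

(** [|x - Z^* Z x|^2 = |x|^2 - 2 |Z x|^2 + |Z^* Z x|^2], and [Z^*] is a
contraction. *)
Lemma defect_contractive : contractive (defect c T T').
Proof.
move=> x; rewrite -ler_sqr ?nnegrE ?nrm_ge0// /defect /= scaleN1r nrmB_sqr.
rewrite -(gap_adjoint c TT') -nrm_sqr.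
have : nrm (gap c^* T' (gap c T x)) ^+ 2 <= nrm (gap c T x) ^+ 2.
  rewrite ler_sqr ?nnegrE ?nrm_ge0//; apply: gap_contractive => //.
  by rewrite normc_conj.
have := sqr_ge0 (nrm (gap c T x)); lra.
Qed.

End Pair.

Lemma gap_strong_limit c b (T : nat -> H -> H) : strong_limit T (fun x => b *: x) ->
  strong_limit (fun n => gap c (T n)) (fun x => ((2^-1)%:C * (b - c)) *: x).
Proof.
move=> Tb x; rewrite -scalerA; apply: cvgZr; rewrite scalerBl -scaleNr.
by apply: cvgD (Tb x) _; apply: cvg_cst.
Qed.

Lemma defect_strong_limit c b (T T' : nat -> H -> H) : normc c <= 1 ->
  (forall n, linear (T' n)) -> (forall n, contractive (T' n)) ->
  strong_limit T (fun x => b *: x) -> strong_limit T' (fun x => b^* *: x) ->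
  strong_limit (fun n => defect c (T n) (T' n))
    (fun x => (1 - normc (b - c) ^+ 2 / 4)%:C *: x).
Proof.
move=> c1 lT' cT' Tb T'b x.
have -> : (1 - normc (b - c) ^+ 2 / 4)%:C *: x = x + -1 *:
    (((2^-1)%:C * (b^* - c^*)) *: (((2^-1)%:C * (b - c)) *: x)).
  rewrite scaleN1r scalerA -{2}[x]scale1r -scalerBl rmorphB rmorph1.
  congr ((_ - _) *: _).
  rewrite -rmorphB /= mulrACA [in RHS]mulrC [_^* * _]mulrC -sqr_normc.
  rewrite rmorphM rmorphXn; congr (_ * _).
  by rewrite -rmorphM; congr (_ %:C); lra.
apply: cvgD; first exact: cvg_cst.
apply: cvgZr.
have lim := @gap_strong_limit c b T Tb x.
have lim' := @gap_strong_limit c^* b^* T' T'b.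
apply: (strong_limit_apply _ _ lim' lim) => n; first exact: gap_linear.
by apply: gap_contractive; rewrite ?normc_conj.
Qed.

End Defect.

Section ThetaAverages.
Variables (R : realType) (G : groupType) (H1 H2 : hilbert R).
Variables (pi1 : unitary_rep G H1) (pi2 : unitary_rep G H2).
Variable theta : (H1 -> H1) -> (H2 -> H2).
Hypothesis iso : star_isomorphism (rep_vN pi1) (rep_vN pi2) theta.
Hypothesis theta_pi : forall g, theta (pi1 g) = pi2 g.

Let S1b := @rep_commutant_bounded _ _ _ pi1.

Lemma theta_id : theta id = id.
Proof. by rewrite -(rep1 pi1) theta_pi rep1. Qed.

Lemma theta_average u k : theta (average pi1 u k) = average pi2 u k.
Proof.
have sumE n : theta (fun x => \sum_(i < n) pi1 (u (2 ^ k + i)%N) x)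
    = (fun x => \sum_(i < n) pi2 (u (2 ^ k + i)%N) x).
  elim: n => [|n IH].
    have -> : (fun x => \sum_(i < 0) pi1 (u (2 ^ k + i)%N) x) = 0 \*: id.
      by apply/funext => x; rewrite big_ord0 /= scale0r.
    rewrite (star_isoZ iso); last exact: commutant_id.
    by apply/funext => x; rewrite big_ord0 /= scale0r.
  have -> : (fun x => \sum_(i < n.+1) pi1 (u (2 ^ k + i)%N) x) =
      (fun x => \sum_(i < n) pi1 (u (2 ^ k + i)%N) x) \+ pi1 (u (2 ^ k + n)%N).
    by apply/funext => x; rewrite big_ord_recr.
  rewrite (star_isoD iso); last exact: rep_in_vN.
    by rewrite IH theta_pi; apply/funext => x; rewrite big_ord_recr.
  apply: (@commutant_sum _ _ _ (fun i => pi1 (u (2 ^ k + i)%N))) => // i.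
  exact: rep_in_vN.
rewrite /average /dyadic_mean.
rewrite (star_isoZ iso) ?sumE//.
apply: (@commutant_sum _ _ _ (fun i => pi1 (u (2 ^ k + i)%N))) => // i.
exact: rep_in_vN.
Qed.

Lemma theta_gap c T : rep_vN pi1 T -> theta (gap c T) = gap c (theta T).
Proof.
move=> MT; have Mid : rep_vN pi1 id := commutant_id _.
have Mc : rep_vN pi1 ((- c) \*: id) by apply: commutant_scale.
have MTc : rep_vN pi1 (T \+ (- c) \*: id) by apply: commutant_add.
by rewrite /gap (star_isoZ iso)// (star_isoD iso)// (star_isoZ iso)// theta_id.
Qed.

Lemma theta_defect c T T' : rep_vN pi1 T -> rep_vN pi1 T' ->
  theta (defect c T T') = defect c (theta T) (theta T').
Proof.
move=> MT MT'; have Mid : rep_vN pi1 id := commutant_id _.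
have Mg := gap_commutant c S1b MT; have Mg' := gap_commutant c^* S1b MT'.
have Mgg := commutant_comp Mg' Mg.
have MN : rep_vN pi1 (-1 \*: (gap c^* T' \o gap c T)) by apply: commutant_scale.
rewrite /defect (star_isoD iso)// (star_isoZ iso)// (star_isoM iso)//.
by rewrite theta_id !theta_gap.
Qed.

End ThetaAverages.

Theorem corollary4 (R : realType) (Gam : topologicalGroupType)
    (sepGam : separable Gam)
    (phi1 phi2 : wreath Gam -> R[i])
    (state1 : is_state phi1) (state2 : is_state phi2)
    (indec1 : indecomposable phi1) (indec2 : indecomposable phi2)
    (central1 : perm_central phi1) (central2 : perm_central phi2)
    (D1 : gns phi1) (D2 : gns phi2)
    (qe : quasiequivalent (gns_rep D1) (gns_rep D2)) :
  phi1 = phi2.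
Proof.
have [[_ _ one1] [_ _ one2]] := (state1, state2).
have [theta [iso theta_pi]] := qe.
apply/funext => g.
have [d d0 g0] := bounded_support g; have gV0 := supportedV g0.
pose u := copy d0 g; pose v := copy d0 g^-1%g.
have uu n m : commute (u n) (u m).
  have [->|/eqP nm] := eqVneq n m; first exact: commute_refl.
  exact: copy_commute.
have vE n : v n = (u n)^-1%g by exact: copyV.
have uv n m : commute (u n) (v m) by rewrite vE; apply/commuteV.
have vv n m : commute (v n) (v m).
  by rewrite [v n]vE; apply/commute_sym/commuteV/commute_sym.
have lim1 := average_copy_strong_limit one1 central1 (indec1 D1) d0 g0.
have lim1V := average_copy_strong_limit one1 central1 (indec1 D1) d0 gV0.
have lim2 := average_copy_strong_limit one2 central2 (indec2 D2) d0 g0.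
have lim2V := average_copy_strong_limit one2 central2 (indec2 D2) d0 gV0.
rewrite (stateV D1) in lim1V; rewrite (stateV D2) in lim2V.
have normc_state (phi : wreath Gam -> R[i]) (D : gns phi) : phi 1%g = 1 ->
    strong_limit (average (gns_rep D) u) (fun x => phi g *: x) -> normc (phi g) <= 1.
  move=> phi1E lim; have := strong_limit_contractive
    (fun k => @average_contractive _ _ _ _ u k) lim.
  by move=> /(_ (gns_vector D)); rewrite nrmZ gns_vector_nrm// mulr1.
have n1 := normc_state _ D1 one1 lim1; have n2 := normc_state _ D2 one2 lim2.
pose L (H : hilbert R) (pi : unitary_rep (wreath Gam) H) k :=
  defect (phi1 g) (average pi u k) (average pi v k).
have adj (H : hilbert R) (pi : unitary_rep (wreath Gam) H) k x y :
    rdot (average pi u k x) y = rdot x (average pi v k y).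
  rewrite average_adjoint; congr (rdot _ (average _ _ _ _)).
  by apply/funext => n; rewrite vE.
have cL (H : hilbert R) (pi : unitary_rep (wreath Gam) H) k : contractive (L H pi k).
  by apply: defect_contractive => //; exact: average_contractive.
have bounded_average (H : hilbert R) (pi : unitary_rep (wreath Gam) H) w k :
    bounded_operator (average pi w k).
  by apply: contractive_bounded; [exact: average_linear|exact: average_contractive].
have thetaL k : theta (L _ (gns_rep D1) k) = L _ (gns_rep D2) k.
  by rewrite /L (theta_defect iso theta_pi) ?(theta_average iso theta_pi)//;
     apply: average_in_vN.
pose r := 1 - normc (phi2 g - phi1 g) ^+ 2 / 4.
suff r1 : r = 1.
  have /eqP : normc (phi2 g - phi1 g) ^+ 2 = 0 by move: r1; rewrite /r; lra.
  by rewrite expf_eq0 /= => /eqP/eq0_normc/eqP; rewrite subr_eq0 => /eqP.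
apply: (@star_iso_strong_limit _ _ _ _ _
  (@rep_commutant_bounded _ _ _ (gns_rep D1)) _ iso (L _ (gns_rep D1)) _ _ _ _ _ _ (gns_vector D1)).
- by move=> k; apply: defect_commutant => [A []//||]; apply: average_in_vN.
- by move=> k; apply: defect_self_adjoint.
- by move=> k; apply: cL.
- move=> k l; apply: defectC => //; apply: average_averageC => // n m.
  exact/commute_sym.
- by move=> k; rewrite thetaL; apply: cL.
- exact: theta_id theta_pi.
- apply/eqP => e; have := gns_vector_nrm one1 D1; rewrite e nrm0 => /eqP.
  by rewrite eq_sym oner_eq0.
- have h : normc (phi2 g - phi1 g) <= 2.
    apply: le_trans (le_normcD _ _) _; rewrite normcN; move: n1 n2; lra.
  have h0 : 0 <= normc (phi2 g - phi1 g).
    by case: (phi2 g - phi1 g) => a b; rewrite sqrtr_ge0.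
  have h2 : normc (phi2 g - phi1 g) ^+ 2 <= 2 ^+ 2 by rewrite ler_sqr ?nnegrE.
  have h3 := sqr_ge0 (normc (phi2 g - phi1 g)).
  by apply/andP; split; rewrite /r; move: h2 h3; rewrite -natrX; lra.
- move=> x; have := @defect_strong_limit _ _ (phi1 g) (phi1 g) _ _ n1
    (@average_linear _ _ _ _ v) (@average_contractive _ _ _ _ v) lim1 lim1V x.
  by rewrite subrr normc0 expr0n /= mul0r subr0 scale1r.
- have -> : (fun k => theta (L _ (gns_rep D1) k)) = L _ (gns_rep D2) by exact/funext.
  exact: (@defect_strong_limit _ _ (phi1 g) (phi2 g) _ _ n1
    (@average_linear _ _ _ _ v) (@average_contractive _ _ _ _ v) lim2 lim2V).
Qed.
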